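(* Let $A\in\mathcal{M}_{n\times n}(\mathbb{R})$, $B\in\mathcal{M}_{n\times m}(\mathbb{R})$, $C\in\mathcal{M}_{n\times n}(\mathbb{R})$, and let $x_0,x_1,z\in\mathbb{R}^n$. Suppose that $(A,B)$ is controllable and that $(A,C)$ satisfies the weak Hautus test. For $T>2$, let $u^T$ be the optimal control for the fixed endpoint problem (with horizon $T$, endpoints $x_0,x_1$ and target $z$) and $x^T$ the optimal state. Then there exist $K$ and $\mu>0$, independent of $T$, such that for every $T>2$ and every $t\in[0,T]$, $$\|u^T(t)-\overline u\|+\|x^T(t)-\overline x\|\le K[\exp(-\mu t)+\exp(-\mu(T-t))],$$ where $(\overline u,\overline x)$ is the unique solution to the steady problem.
   Context: $\mathcal{M}_{p\times q}(\mathbb{R})$ is the set of real $p\times q$ matrices; $\|\cdot\|$ is the Euclidean norm; $^*$ denotes transpose. Fixed endpoint problem: minimize $J^T(u)=\frac12\int_0^T[\|u(t)\|^2+\|Cx(t)-z\|^2]\,dt$ over those $u\in L^2(0,T;\mathbb{R}^m)$ for which the solution $x$ of $\dot x=Ax+Bu$ in $(0,T)$, $x(0)=x_0$, satisfies $x(T)=x_1$. When $(A,B)$ is controllable there is a unique optimal control $u^T$; it has a continuous representative $u^T=-B^*p^T$, where $(x^T,p^T)$ is the unique solution of $\dot x^T=Ax^T-BB^*p^T$, $-\dot p^T=A^*p^T+C^*(Cx^T-z)$, $x^T(0)=x_0$, $x^T(T)=x_1$. Steady problem: minimize $J_s(u,x)=\frac12\|u\|^2+\frac12\|Cx-z\|^2$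 over $(u,x)\in\mathbb{R}^m\times\mathbb{R}^n$ subject to $Ax+Bu=0$. Weak Hautus test: $(A,C)$ satisfies it if $\mathrm{rank}\begin{bmatrix}A-i\beta I\\ C\end{bmatrix}=n$ for every $\beta\in\mathbb{R}$ such that $i\beta$ belongs to the spectrum of $A$ ($i$ the imaginary unit). *)

(* Defs.v *)
From mathcomp Require Import all_boot all_order all_algebra.
From mathcomp Require Import all_classical all_reals all_analysis.
From mathcomp Require Import complex.

Set Implicit Arguments.
Unset Strict Implicit.
Unset Printing Implicit Defensive.

Import Order.TTheory GRing.Theory Num.Theory.
Import numFieldNormedType.Exports.

Local Open Scope classical_set_scope.
Local Open Scope ring_scope.
Local Open Scope complex_scope.

(* The norm [`|v|] supplied by the library on matrices is the sup norm. *)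
Definition enorm (R : realType) (k : nat) (v : 'cV[R]_k) : R :=
  Num.sqrt (\sum_i v i 0 ^+ 2).

(* A function on (0, T) is represented by a total function on [R] whose values
   outside [0, T] are irrelevant; the endpoints are Lebesgue-null. *)
Definition L2_control (R : realType) (m : nat) (T : R) (u : R -> 'cV[R]_m) : Prop :=
  forall i : 'I_m,
    measurable_fun (`[0, T] : set R) (fun t => u t i 0) /\
    lebesgue_measure.-integrable (`[0, T] : set R) (fun t => ((u t i 0) ^+ 2)%:E).

(* Caratheodory solution of x' = A x + B u on (0, T) with x(0) = x0, in integral
   form.  The integrability clause is what makes the real-valued integral
   meaningful. *)
Definition state_of (R : realType) (n m : nat) (A : 'M[R]_n) (B : 'M[R]_(n, m))
    (T : R) (x0 : 'cV[R]_n) (u : R -> 'cV[R]_m) (x : R -> 'cV[R]_n) : Prop :=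
  forall i : 'I_n,
    lebesgue_measure.-integrable (`[0, T] : set R)
      (fun s => ((A *m x s + B *m u s) i 0)%:E) /\
    (forall t, 0 <= t <= T ->
      x t i 0 = x0 i 0 +
        Rintegral lebesgue_measure (`[0, t] : set R)
          (fun s => (A *m x s + B *m u s) i 0)).

Definition admissible (R : realType) (n m : nat) (A : 'M[R]_n)
    (B : 'M[R]_(n, m)) (T : R) (x0 x1 : 'cV[R]_n)
    (u : R -> 'cV[R]_m) (x : R -> 'cV[R]_n) : Prop :=
  [/\ L2_control T u, state_of A B T x0 u x & x T = x1].

(* The transfer time may depend on the pair of endpoints; for these
   time-invariant systems this is equivalent to controllability in every
   positive time, and it is the weakest form of the hypothesis. *)
Definition controllable (R : realType) (n m : nat) (A : 'M[R]_n)
    (B : 'M[R]_(n, m)) : Prop :=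
  forall x0 x1 : 'cV[R]_n,
    exists T : R, 0 < T /\ exists u x, admissible A B T x0 x1 u x.

Definition weak_Hautus (R : realType) (n p : nat) (A : 'M[R]_n)
    (C : 'M[R]_(p, n)) : Prop :=
  let AC : 'M[R[i]]_n := map_mx (real_complex R) A in
  let CC : 'M[R[i]]_(p, n) := map_mx (real_complex R) C in
  forall b : R, eigenvalue AC (0 +i* b) ->
    \rank (col_mx (AC - (0 +i* b)%:M)%R CC) = n.

(* J^T(u), with the state x associated with u passed explicitly. *)
Definition cost (R : realType) (n m p : nat) (C : 'M[R]_(p, n)) (z : 'cV[R]_p)
    (T : R) (u : R -> 'cV[R]_m) (x : R -> 'cV[R]_n) : R :=
  2^-1 * Rintegral lebesgue_measure (`[0, T] : set R)
           (fun t => enorm (u t) ^+ 2 + enorm (C *m x t - z) ^+ 2).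

Definition optimal (R : realType) (n m p : nat) (A : 'M[R]_n)
    (B : 'M[R]_(n, m)) (C : 'M[R]_(p, n)) (z : 'cV[R]_p) (T : R)
    (x0 x1 : 'cV[R]_n) (u : R -> 'cV[R]_m) (x : R -> 'cV[R]_n) : Prop :=
  admissible A B T x0 x1 u x /\
  forall v y, admissible A B T x0 x1 v y -> cost C z T u x <= cost C z T v y.

Definition steady_cost (R : realType) (n m p : nat) (C : 'M[R]_(p, n))
    (z : 'cV[R]_p) (u : 'cV[R]_m) (x : 'cV[R]_n) : R :=
  2^-1 * enorm u ^+ 2 + 2^-1 * enorm (C *m x - z) ^+ 2.

Definition steady_optimal (R : realType) (n m p : nat) (A : 'M[R]_n)
    (B : 'M[R]_(n, m)) (C : 'M[R]_(p, n)) (z : 'cV[R]_p)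
    (u : 'cV[R]_m) (x : 'cV[R]_n) : Prop :=
  A *m x + B *m u = 0 /\
  forall v y, A *m y + B *m v = 0 -> steady_cost C z u x <= steady_cost C z v y.

(* Main.v *)
Require Import Defs.
From mathcomp Require Import all_boot all_order all_algebra.
From mathcomp Require Import all_classical all_reals all_analysis.
From mathcomp Require Import measurable_realfun complex.
From mathcomp Require Import ring lra.
Set Implicit Arguments.
Unset Strict Implicit.
Unset Printing Implicit Defensive.
Import Order.TTheory GRing.Theory Num.Theory.
Import numFieldNormedType.Exports.
Local Open Scope classical_set_scope.
Local Open Scope ring_scope.

(** Let H be the Hamiltonian matrix of the problem, acting on pairs (y, q) of
    a state and a costate, both measured from the steady optimum.  An optimal
    trajectory is the state part of a solution of w' = H w, with control
    deviation - B^* q, so the estimate is a statement about such solutions.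

    H has no eigenvalue on the imaginary axis ([ham_hyperbolic]): pairing the
    two rows of the eigenvector equation gives B^* q = 0 and C y = 0, and then
    the Hautus test kills y while controllability kills q.  A real quadratic
    form V that decreases strictly along w' = H w therefore exists
    ([lyapunov_form]).  No sign of V is known, but V' <= - a |V| makes both
    e^(a t) V(t) and e^(- a t) V(t) nonincreasing, which bounds V(t) by
    e^(- a t) + e^(- a (T - t)) times the size of w at the two ends.  The mean
    value theorem over a window of length one turns this into a bound on w
    itself ([solution_decay]).

    It remains to bound w(0) and w(T) independently of T, whereas only the
    state parts y(0) and y(T) are prescribed.  The pairing (y | q) has
    derivative - (|B^* q|^2 + |C y|^2).  Its loss over a unit time, increased by
    |y(0)|^2, is a positive definite form of w(0) by the Kalman condition
    ([observability_form]).  As the loss over [0, T] is (y | q)(0) - (y | q)(T),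
    which is linear in q, Young's inequality absorbs the costate
    ([endpoint_bound]).  The same bound makes the boundary value problem
    solvable ([boundary_problem]).

    Finally a continuous optimal control is compared with the solution of this
    boundary value problem.  The difference of the running costs up to time t,
    corrected by (p(t) | x(t) - xh(t)), where xh and p are the state and the
    costate of that solution, has a nonnegative derivative; it vanishes at 0
    and is nonpositive at T by optimality, hence is constant, and its derivative
    dominates the squared distance of the two controls ([optimal_extremal]).

    The Kalman condition is obtained from controllability by projecting a
    transfer to the annihilated vectors: the projected state solves an
    autonomous linear equation, so it cannot leave 0 ([controllable_kalman]). *)

(** * Euclidean inner product *)

Section InnerProduct.
Variable R : realType.

Definition dot k (u v : 'cV[R]_k) : R := \sum_i u i 0 * v i 0.

Lemma dotC k (u v : 'cV[R]_k) : dot u v = dot v u.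
Proof. by apply: eq_bigr => i _; rewrite mulrC. Qed.

Lemma dotDl k (u v w : 'cV[R]_k) : dot (u + v) w = dot u w + dot v w.
Proof. by rewrite -big_split; apply: eq_bigr => i _; rewrite mxE mulrDl. Qed.

Lemma dotZl k a (u v : 'cV[R]_k) : dot (a *: u) v = a * dot u v.
Proof. by rewrite mulr_sumr; apply: eq_bigr => i _; rewrite mxE mulrA. Qed.

Lemma dotDr k (u v w : 'cV[R]_k) : dot u (v + w) = dot u v + dot u w.
Proof. by rewrite dotC dotDl !(dotC u). Qed.

Lemma dotZr k a (u v : 'cV[R]_k) : dot u (a *: v) = a * dot u v.
Proof. by rewrite dotC dotZl dotC. Qed.

Lemma dotNl k (u v : 'cV[R]_k) : dot (- u) v = - dot u v.
Proof. by rewrite -scaleN1r dotZl mulN1r. Qed.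

Lemma dotNr k (u v : 'cV[R]_k) : dot u (- v) = - dot u v.
Proof. by rewrite dotC dotNl dotC. Qed.

Lemma dot0l k (u : 'cV[R]_k) : dot 0 u = 0.
Proof. by rewrite -(scale0r 0) dotZl mul0r. Qed.

Lemma dot0r k (u : 'cV[R]_k) : dot u 0 = 0.
Proof. by rewrite dotC dot0l. Qed.

Definition dotE := (dotDl, dotDr, dotNl, dotNr, dotZl, dotZr, dot0l, dot0r).

Lemma dot_mx k (u v : 'cV[R]_k) : dot u v = (u^T *m v) 0 0.
Proof. by rewrite mxE; apply: eq_bigr => i _; rewrite mxE. Qed.

Lemma dot_mulmxr k l (M : 'M[R]_(k, l)) u v : dot u (M *m v) = dot (M^T *m u) v.
Proof. by rewrite !dot_mx mulmxA trmx_mul trmxK. Qed.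

Lemma dot_mulmxl k l (M : 'M[R]_(k, l)) u v : dot (M *m u) v = dot u (M^T *m v).
Proof. by rewrite dot_mulmxr trmxK. Qed.

Lemma dot_ge0 k (u : 'cV[R]_k) : 0 <= dot u u.
Proof. by apply: sumr_ge0 => i _; rewrite -expr2 sqr_ge0. Qed.

Lemma sqr_entry_le_dot k (u : 'cV[R]_k) i : u i 0 ^+ 2 <= dot u u.
Proof.
rewrite /dot (bigD1 i) //= -expr2 lerDl.
by apply: sumr_ge0 => j _; rewrite -expr2 sqr_ge0.
Qed.

Lemma dot_le0 k (u : 'cV[R]_k) : dot u u <= 0 -> u = 0.
Proof.
move=> u0; apply/matrixP => i j; rewrite ord1 mxE.
by apply/eqP; rewrite -sqrf_eq0 eq_le sqr_ge0 andbT (le_trans (sqr_entry_le_dot _ _)).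
Qed.

Lemma dot_col_mx k l (a c : 'cV[R]_k) (b d : 'cV[R]_l) :
  dot (col_mx a b) (col_mx c d) = dot a c + dot b d.
Proof.
rewrite /dot big_split_ord /=.
by congr (_ + _); apply: eq_bigr => i _; rewrite ?col_mxEu ?col_mxEd.
Qed.

Lemma mx_inj_unit k (S : 'M[R]_k) :
  (forall w : 'cV[R]_k, S *m w = 0 -> w = 0) -> S \in unitmx.
Proof.
move=> inj; rewrite -unitmx_tr -row_free_unit -kermx_eq0; apply/rowV0P => v.
move=> /sub_kermxP vS; apply: trmx_inj; rewrite trmx0; apply: inj.
by apply: trmx_inj; rewrite trmx_mul trmxK vS trmx0.
Qed.

Lemma dot_bound k (M : 'M[R]_k) : exists2 h : R, 0 < h &
  forall u, `|dot u (M *m u)| <= h * dot u u.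
Proof.
exists (1 + \sum_i \sum_j `|M i j|).
  by rewrite ltr_pwDl// sumr_ge0// => i _; rewrite sumr_ge0.
move=> u; rewrite mulrDl mul1r ler_wpDl ?dot_ge0// {1}/dot mulr_suml.
apply: le_trans (ler_norm_sum _ _ _) _; apply: ler_sum => i _.
rewrite mxE mulr_sumr mulr_suml.
apply: le_trans (ler_norm_sum _ _ _) _; apply: ler_sum => j _.
rewrite mulrCA normrM ler_wpM2l//.
have := sqr_entry_le_dot u i; have := sqr_entry_le_dot u j.
rewrite ler_norml; move: (u i 0) (u j 0) (dot u u) => a b d.
have := sqr_ge0 (a + b); have := sqr_ge0 (a - b); nra.
Qed.

Lemma mulmx_bound k l (M : 'M[R]_(k, l)) : exists2 h : R, 0 < h &
  forall u, dot (M *m u) (M *m u) <= h * dot u u.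
Proof.
have [h h0 hP] := dot_bound (M^T *m M); exists h => // u.
by rewrite dot_mulmxl mulmxA (le_trans (ler_norm _)).
Qed.

Lemma sqr_enorm k (u : 'cV[R]_k) : enorm u ^+ 2 = dot u u.
Proof.
rewrite sqr_sqrtr; first by apply: eq_bigr => i _; rewrite expr2.
by apply: sumr_ge0 => i _; rewrite sqr_ge0.
Qed.

Lemma enorm_ge0 k (u : 'cV[R]_k) : 0 <= enorm u.
Proof. exact: sqrtr_ge0. Qed.

Lemma enorm_le k (v : 'cV[R]_k) (c g : R) :
  0 <= c -> 0 <= g -> dot v v <= c * g ^+ 2 -> enorm v <= Num.sqrt c * g.
Proof.
move=> c0 g0 vle; rewrite -[g]ger0_norm// -sqrtr_sqr -sqrtrM//.
rewrite -[enorm v]ger0_norm ?enorm_ge0// -sqrtr_sqr sqr_enorm.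
exact: ler_wsqrtr.
Qed.

End InnerProduct.

(** * Calculus of vector-valued functions *)

Section Calculus.
Variable R : realType.

(** Derivatives and continuity are taken entry by entry, so that every entry is
    an ordinary real function of time to which scalar calculus applies. *)
Definition has_deriv k (w : R -> 'cV[R]_k) (t : R) (a : 'cV[R]_k) :=
  forall i, is_derive t 1 (fun s => w s i 0 : R) (a i 0).

Definition vcont k (a b : R) (w : R -> 'cV[R]_k) :=
  forall i, {within `[a, b], continuous (fun t => w t i 0 : R)}.

Lemma has_deriv_mulmx k l (M : 'M[R]_(k, l)) w t a :
  has_deriv w t a -> has_deriv (fun s => M *m w s) t (M *m a).
Proof.
move=> wa i.
have -> : (fun s => (M *m w s) i 0) = \sum_j (M i j \*: (fun s => w s j 0)).
  by apply/funext => s; rewrite mxE fct_sumE.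
by rewrite mxE; apply: is_derive_sum => j; apply: is_deriveZ; exact: wa.
Qed.

Lemma has_derivD k (w v : R -> 'cV[R]_k) t a b :
  has_deriv w t a -> has_deriv v t b -> has_deriv (fun s => w s + v s) t (a + b).
Proof.
move=> wa vb i; rewrite mxE.
have -> : (fun s => (w s + v s) i 0) = (fun s => w s i 0) + (fun s => v s i 0).
  by apply/funext => s; rewrite mxE.
by apply: is_deriveD; [exact: wa|exact: vb].
Qed.

Lemma has_derivN k (w : R -> 'cV[R]_k) t a :
  has_deriv w t a -> has_deriv (fun s => - w s) t (- a).
Proof.
move=> wa i; rewrite mxE.
have -> : (fun s => (- w s) i 0) = - (fun s => w s i 0).
  by apply/funext => s; rewrite mxE.
by apply: is_deriveN; exact: wa.
Qed.

Lemma has_deriv_cst k (c : 'cV[R]_k) t : has_deriv (fun=> c) t 0.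
Proof. by move=> i; rewrite mxE; exact: is_derive_cst. Qed.

Lemma is_derive_dot k (w v : R -> 'cV[R]_k) t a b :
  has_deriv w t a -> has_deriv v t b ->
  is_derive t 1 (fun s => dot (w s) (v s)) (dot a (v t) + dot (w t) b).
Proof.
move=> wa vb.
have -> : (fun s => dot (w s) (v s)) =
    \sum_i ((fun s => w s i 0) * (fun s => v s i 0)).
  by apply/funext => s; rewrite fct_sumE.
rewrite -big_split /=; apply: is_derive_sum => i.
apply: is_derive_eq; first by apply: is_deriveM; [exact: wa|exact: vb].
by rewrite /GRing.scale /=; ring.
Qed.

Lemma continuous_sum (A : set R) n (F : 'I_n -> R -> R) :
  (forall i, {within A, continuous (F i)}) ->
  {within A, continuous (fun t => \sum_i F i t)}.
Proof.
elim: n F => [|n IH] F cF.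
  by rewrite (_ : (fun t => _) = fun=> 0); [move=> x; exact: cvg_cst|
    apply/funext => t; rewrite big_ord0].
rewrite (_ : (fun t => _) =
    fun t => \sum_i F (widen_ord (leqnSn n) i) t + F ord_max t); last first.
  by apply/funext => t; rewrite big_ord_recr.
by move=> x; apply: cvgD; [apply: IH => i; exact: cF|exact: cF].
Qed.

Lemma vcont_mulmx k l (M : 'M[R]_(k, l)) a b w :
  vcont a b w -> vcont a b (fun s => M *m w s).
Proof.
move=> cw i.
rewrite (_ : (fun t => _) = fun t => \sum_j (M i j * w t j 0)); last first.
  by apply/funext => s; rewrite mxE.
by apply: continuous_sum => j x; apply: cvgM; [exact: cvg_cst|exact: cw].
Qed.

Lemma continuous_dot k a b (w v : R -> 'cV[R]_k) :
  vcont a b w -> vcont a b v ->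
  {within `[a, b], continuous (fun t => dot (w t) (v t) : R)}.
Proof.
by move=> cw cv; apply: continuous_sum => j x; apply: cvgM; [exact: cw|exact: cv].
Qed.

Lemma vcontD k a b (w v : R -> 'cV[R]_k) :
  vcont a b w -> vcont a b v -> vcont a b (fun t => w t + v t).
Proof.
move=> cw cv i.
rewrite (_ : (fun t => _) = fun t => w t i 0 + v t i 0); last first.
  by apply/funext => s; rewrite mxE.
by move=> x; apply: cvgD; [exact: cw|exact: cv].
Qed.

Lemma vcontN k a b (w : R -> 'cV[R]_k) :
  vcont a b w -> vcont a b (fun t => - w t).
Proof.
move=> cw i.
rewrite (_ : (fun t => _) = fun t => - w t i 0); last first.
  by apply/funext => s; rewrite mxE.
by move=> x; apply: cvgN; exact: cw.
Qed.

Lemma vcont_cst k a b (c : 'cV[R]_k) : vcont a b (fun=> c).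
Proof. by move=> i x; exact: cvg_cst. Qed.

Lemma has_deriv_vcont k (w f : R -> 'cV[R]_k) a b :
  (forall t, has_deriv w t (f t)) -> vcont a b w.
Proof.
move=> wf i; apply: derivable_within_continuous => t _.
by have /(_ i) [] := wf t.
Qed.

Lemma has_deriv_col_mx k l (u : R -> 'cV[R]_k) (v : R -> 'cV[R]_l) t a b :
  has_deriv u t a -> has_deriv v t b ->
  has_deriv (fun s => col_mx (u s) (v s)) t (col_mx a b).
Proof.
move=> ua vb i; case: (split_ordP i) => j ->.
  rewrite col_mxEu (_ : (fun s => _) = fun s => u s j 0); first exact: ua.
  by apply/funext => s; rewrite col_mxEu.
rewrite col_mxEd (_ : (fun s => _) = fun s => v s j 0); first exact: vb.
by apply/funext => s; rewrite col_mxEd.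
Qed.

Lemma has_deriv_reverse k (w : R -> 'cV[R]_k) (T t : R) a :
  has_deriv w (T - t) a -> has_deriv (fun s => w (T - s)) t (- a).
Proof.
move=> wa i; rewrite mxE -mulrN1.
have dT : is_derive t 1 (fun s => T - s : R) (-1).
  by have := is_deriveB (is_derive_cst T t (1 : R)) (is_derive_id t (1 : R)); rewrite sub0r.
by have := @is_derive1_comp _ (fun s => w s i 0) (fun s => T - s) t _ _ (wa i) dT.
Qed.

Lemma continuous_vcont k (a b : R) (w : R -> 'cV[R]_k) :
  {within `[a, b], continuous w} -> vcont a b w.
Proof.
move=> cw i t; apply: (@cvg_comp _ _ _ w (fun M : 'cV[R]_k => M i 0 : R) _ _ _
  (cw t) (@coord_continuous R _ _ i 0 (w t))).
Qed.

Lemma derive_ge0_le (f df : R -> R) (a b : R) :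
  (forall t, a < t < b -> is_derive t 1 f (df t)) ->
  (forall t, a < t < b -> 0 <= df t) ->
  {within `[a, b], continuous f} ->
  forall x y, a <= x -> x <= y -> y <= b -> f x <= f y.
Proof.
move=> fd d0 cf x y ax xy yb.
apply: (ger0_derive1_le_cc _ _ cf) => //; rewrite ?in_itv/=.
- by move=> t; rewrite in_itv/= => /fd [].
- by move=> t; rewrite in_itv/= => abt; rewrite derive1E (@derive_val _ _ _ _ _ _ _ (fd t abt)) d0.
- by rewrite ax (le_trans xy).
- by rewrite yb (le_trans ax).
Qed.

Lemma derive_le0_ge (f df : R -> R) (a b : R) :
  (forall t, a < t < b -> is_derive t 1 f (df t)) ->
  (forall t, a < t < b -> df t <= 0) ->
  {within `[a, b], continuous f} ->
  forall x y, a <= x -> x <= y -> y <= b -> f y <= f x.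
Proof.
move=> fd d0 cf x y ax xy yb; rewrite -lerN2.
apply: (@derive_ge0_le (fun t => - f t) (fun t => - df t) a b) => //.
- by move=> t /fd ft; exact: is_deriveN.
- by move=> t /d0; rewrite oppr_ge0.
- by move=> z; apply: cvgN; exact: cf.
Qed.

Lemma derive0_const (f : R -> R) (a b : R) :
  (forall t : R, a < t < b -> is_derive t 1 f 0) ->
  {within `[a, b], continuous f} ->
  forall s t, a <= s <= b -> a <= t <= b -> f s = f t.
Proof.
move=> fd cf; suff H s t : a <= s -> s <= t -> t <= b -> f s = f t.
  move=> s t /andP[as_ sb] /andP[at_ tb].
  by have [/H->//|/ltW/H->//] := leP s t.
move=> as_ st tb; apply/le_anti/andP; split.
  exact: (derive_ge0_le (df := fun=> 0) fd _ cf).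
exact: (derive_le0_ge (df := fun=> 0) fd _ cf).
Qed.

Lemma is_derive_expR_scale (c t : R) :
  is_derive t 1 (fun s => expR (c * s) : R) (c * expR (c * t)).
Proof.
have ds : is_derive t 1 (fun s => c * s : R) c.
  rewrite (_ : (fun s => _) = c \*: (id : R -> R)); last exact/funext.
  have := is_deriveZ c (is_derive_id t (1 : R)).
  by rewrite /GRing.scale /= mulr1.
have dE := is_derive_expR (c * t).
by have := is_derive1_comp dE ds; rewrite mulrC.
Qed.

Lemma is_derive_expR_mul (f : R -> R) (c t df : R) : is_derive t 1 f df ->
  is_derive t 1 (fun s => expR (c * s) * f s) (expR (c * t) * (df + c * f t)).
Proof.
move=> fd.
apply: is_derive_eq (is_deriveM (is_derive_expR_scale c t) fd) _.
by rewrite /GRing.scale /=; ring.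
Qed.

Lemma continuous_expR_mul (f : R -> R) (c a b : R) :
  {within `[a, b], continuous f} ->
  {within `[a, b], continuous (fun s => expR (c * s) * f s)}.
Proof.
move=> cf x; apply: cvgM; last exact: cf.
apply: derivable_within_continuous => t _.
by have [] := is_derive_expR_scale c t.
Qed.

(** The integrating factor of the differential inequality is [expR (c * t)].
    The sign of [c] is free: growth and decay estimates use both. *)
Lemma gronwall (f df : R -> R) (c a b : R) :
  (forall t, a < t < b -> is_derive t 1 f (df t)) ->
  (forall t, a < t < b -> df t + c * f t <= 0) ->
  {within `[a, b], continuous f} ->
  forall s t, a <= s -> s <= t -> t <= b -> expR (c * t) * f t <= expR (c * s) * f s.
Proof.
move=> fd d0 cf.
apply: (@derive_le0_ge _ (fun t => expR (c * t) * (df t + c * f t))).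
- by move=> t /fd; exact: is_derive_expR_mul.
- by move=> t /d0; rewrite pmulr_rle0// expR_gt0.
- exact: continuous_expR_mul.
Qed.

(** The squared norm of a solution has derivative [2 * dot w (H w)], which is
    bounded both ways by a multiple of the squared norm; hence the estimate holds
    forward and backward in time. *)
Lemma linear_growth k (H : 'M[R]_k) : exists2 h : R, 0 < h &
  forall (w : R -> 'cV[R]_k) a b, vcont a b w ->
  (forall t, a < t < b -> has_deriv w t (H *m w t)) ->
  forall s t, a <= s <= b -> a <= t <= b ->
  dot (w t) (w t) <= expR (h * `|t - s|) * dot (w s) (w s).
Proof.
have [h h0 hP] := dot_bound H; exists (2 * h); first by rewrite mulr_gt0.
move=> w a b cw dw.
pose f t := dot (w t) (w t); pose df t := 2 * dot (w t) (H *m w t).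
have fd t : a < t < b -> is_derive t 1 f (df t).
  move=> /dw dwt; apply: is_derive_eq; first exact: (is_derive_dot dwt dwt).
  by rewrite dotC /df mulr_natl.
have cf : {within `[a, b], continuous f} by exact: continuous_dot.
have up := gronwall fd (c := - (2 * h)) _ cf.
have dn := gronwall (f := fun t => - f t) (df := fun t => - df t) (c := 2 * h) _ _ _.
have {}up : forall s t, a <= s -> s <= t -> t <= b ->
    expR (- (2 * h) * t) * f t <= expR (- (2 * h) * s) * f s.
  apply: up => t _; rewrite /df /f; have := hP (w t); rewrite ler_norml => /andP[_].
  lra.
have {}dn : forall s t, a <= s -> s <= t -> t <= b ->
    expR (2 * h * t) * - f t <= expR (2 * h * s) * - f s.
  apply: dn.
  - by move=> t /fd; exact: is_deriveN.
  - move=> t _; rewrite /df /f; have := hP (w t); rewrite ler_norml => /andP[+ _].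
    lra.
  - by move=> z; apply: cvgN; exact: cf.
move=> s t /andP[as_ sb] /andP[at_ tb].
have [st|/ltW ts] := leP s t.
  rewrite ger0_norm ?subr_ge0//.
  have := up _ _ as_ st tb; rewrite -(ler_pM2l (expR_gt0 (2 * h * t))).
  rewrite !mulrA -!expRD mulNr subrr expR0 mul1r.
  by rewrite mulNr -mulrBr.
rewrite distrC ger0_norm ?subr_ge0//.
have := dn _ _ at_ ts sb; rewrite -(ler_pM2l (expR_gt0 (- (2 * h * t)))).
rewrite !mulrA -!expRD addNr expR0 mul1r mulrN lerN2.
by rewrite addrC -mulrBr.
Qed.

Lemma linear_ode_unique k (H : 'M[R]_k) (w : R -> 'cV[R]_k) a b :
  vcont a b w -> (forall t, a < t < b -> has_deriv w t (H *m w t)) ->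
  forall s t, a <= s <= b -> a <= t <= b -> w s = 0 -> w t = 0.
Proof.
move=> cw dw s t sab tab ws.
have [h _ hP] := linear_growth H.
by apply: dot_le0; have := hP w a b cw dw s t sab tab; rewrite ws dot0l mulr0.
Qed.

End Calculus.

(** * Fundamental matrix of a linear system *)

Section Flow.
Variable R : realType.

Lemma cvg_pseries_expcoeff (a : nat -> R) (M h t : R) :
  0 <= h -> (forall k, `|a k| <= M * h ^+ k) ->
  cvgn (pseries (fun k => a k / k`!%:R) t).
Proof.
move=> h0 ah; apply: normed_cvg.
apply: (@series_le_cvg _ _ (M *: exp_coeff (h * `|t|))).
- by move=> n /=.
- move=> n; rewrite /exp_coeff /=; apply: mulr_ge0.
    by rewrite (le_trans (normr_ge0 (a 0)))// (le_trans (ah 0))// expr0 mulr1.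
  by rewrite divr_ge0// exprn_ge0// mulr_ge0.
- move=> n; rewrite /exp_coeff /= !normrM normfV [X in _ / X]ger0_norm// normrX.
  apply: (@le_trans _ _ (M * h ^+ n / n`!%:R * `|t| ^+ n)).
    by rewrite ler_wpM2r ?exprn_ge0// ler_wpM2r// invr_ge0.
  by rewrite le_eqVlt; apply/orP; left; apply/eqP; rewrite fctE /= exprMn /GRing.scale /=; ring.
by apply: is_cvg_seriesZ; exact: is_cvg_series_exp_coeff.
Qed.

(** Multiplication by [H] enlarges the greatest entry at most by the greatest row
    sum of absolute values, hence at most by the sum [h] of all of them. *)
Lemma mx_power_bound k (H : 'M[R]_k) : exists2 h : R, 0 <= h &
  forall p i j, `|(iter p (mulmx H) 1%:M) i j| <= h ^+ p.
Proof.
exists (\sum_i \sum_j `|H i j|).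
  by apply: sumr_ge0 => i _; exact: sumr_ge0.
elim=> [|p IH] i j.
  by rewrite expr0 /= mxE; case: eqP; rewrite ?normr1// normr0.
rewrite iterS mxE exprS; apply: le_trans (ler_norm_sum _ _ _) _.
apply: (@le_trans _ _ (\sum_l `|H i l| * (\sum_i \sum_j `|H i j|) ^+ p)).
  by apply: ler_sum => l _; rewrite normrM ler_wpM2l.
rewrite -mulr_suml ler_wpM2r ?exprn_ge0//.
  by apply: sumr_ge0 => ? _; exact: sumr_ge0.
rewrite [leRHS](bigD1 i)//= lerDl.
by apply: sumr_ge0 => ? _; exact: sumr_ge0.
Qed.

(** [E] is the exponential series of [H], summed entry by entry: each entry is a
    power series with coefficients [(H ^ p) i j / p!], and differentiating it
    shifts [p] by one. *)
Lemma matrix_flow k (H : 'M[R]_k) : exists E : R -> 'M[R]_k,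
  E 0 = 1%:M /\
  forall (t : R) i j, is_derive t 1 (fun s => E s i j : R) ((H *m E t) i j).
Proof.
have [h h0 hP] := mx_power_bound H.
pose P p := iter p (mulmx H) 1%:M.
(* The shift [q] makes the family [c] stable under differentiation. *)
pose c q i j p := (P (q + p)%N i j) / p`!%:R : R.
have cc q i j t : cvgn (pseries (c q i j) t).
  apply: (@cvg_pseries_expcoeff (fun p => P (q + p)%N i j) (h ^+ q) h) => // p.
  by rewrite -exprD; exact: hP.
have dc q i j : pseries_diffs (c q i j) = c q.+1 i j.
  apply/funext => p; rewrite /pseries_diffs /c addnS addSn factS natrM invfM.
  by rewrite mulrCA mulVKf.
exists (fun t => \matrix_(i, j) limn (pseries (c 0%N i j) t)); split.
  apply/matrixP => i j; rewrite mxE; apply: cvg_lim => //.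
  rewrite -cvg_shiftS; apply: cvg_near_cst; near=> p.
  rewrite /pseries /series /= big_nat_recl// big1_seq => [|l _]; last first.
    by rewrite expr0n mulr0.
  by rewrite addr0 /c fact0 expr0 invr1 !mulr1.
move=> t i j.
rewrite (_ : (fun s => _) = fun s => limn (pseries (c 0%N i j) s)); last first.
  by apply/funext => s; rewrite mxE.
rewrite (_ : (H *m _) i j = limn (pseries (pseries_diffs (c 0%N i j)) t)).
  apply: (@pseries_snd_diffs _ _ (`|t| + 1)); rewrite ?dc//.
  by rewrite [ltRHS]ger0_norm// ltrDl.
rewrite dc mxE; apply/esym/cvg_lim => //.
rewrite (_ : pseries _ _ = fun n => \sum_l H i l * pseries (c 0%N l j) t n).
  apply: cvg_big => [|l _]; first exact: add_continuous.
  by apply: cvgM; [exact: cvg_cst|rewrite mxE; exact: cc].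
apply/funext => n; rewrite /pseries /series /=.
under [in RHS]eq_bigr do rewrite mulr_sumr.
rewrite exchange_big; apply: eq_bigr => p _ /=.
rewrite /c /P add0n add1n iterS mxE !mulr_suml; apply: eq_bigr => l _.
by rewrite !mulrA.
Unshelve. all: by end_near. Qed.

End Flow.

(** * From controllability to the Kalman condition *)

Section Kalman.
Variable R : realType.

(** Duality form of the Kalman rank condition: the rows of the controllability
    matrix have no common annihilator.  Powers are written as iterates because
    they act on vectors and the exponent is arbitrary. *)
Definition kalman n m (A : 'M[R]_n) (B : 'M[R]_(n, m)) :=
  forall p : 'cV[R]_n, (forall k, B^T *m iter k (mulmx A^T) p = 0) -> p = 0.

Lemma interior_continuous (f : R -> R) (a b t : R) :
  {within `[a, b], continuous f} -> a < t < b -> {for t, continuous f}.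
Proof.
move=> cf atb; have ab : a < b by case/andP: atb; exact: lt_trans.
case: ((continuous_within_itvP f ab).1 cf) => + _ _.
by move=> /(_ t); rewrite in_itv/= => /(_ atb).
Qed.

Lemma near_itvoo (a b t : R) : a < t < b -> \forall s \near t, a < s < b.
Proof.
move=> /andP[at_ tb]; near=> s; apply/andP; split; near: s.
  exact: lt_nbhsr.
exact: lt_nbhsl.
Unshelve. all: by end_near. Qed.

(** The next two lemmas recover the regularity of a Caratheodory solution from
    its integral equation: continuity always, and differentiability in the
    interior when the integrand is continuous. *)
Lemma integral_eq_continuous (f g : R -> R) (c T : R) : 0 <= T ->
  lebesgue_measure.-integrable `[0, T] (EFin \o f) ->
  (forall t, 0 <= t <= T ->
    g t = c + Rintegral lebesgue_measure `[0, t] f) ->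
  {within `[0, T], continuous g}.
Proof.
move=> T0 intf gE.
apply: (@subspace_eq_continuous _ _ _
  (fun t => c + parameterized_integral lebesgue_measure 0 t f)).
  by move=> t; rewrite inE /= in_itv/= => /gE H; exact/esym.
move=> x; apply: cvgD; first exact: cvg_cst.
exact: parameterized_integral_continuous.
Qed.

Lemma integral_eq_derive (f g : R -> R) (c T : R) :
  lebesgue_measure.-integrable `[0, T] (EFin \o f) ->
  {within `[0, T], continuous f} ->
  (forall t, 0 <= t <= T ->
    g t = c + Rintegral lebesgue_measure `[0, t] f) ->
  forall t, 0 < t < T -> is_derive t 1 g (f t).
Proof.
move=> intf cf gE t tT; have [t0 t1] := andP tT.
have [dF FE] := continuous_FTC1_closed t1 intf t0 (interior_continuous cf tT).
pose F x := Rintegral lebesgue_measure `[0, x] f.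
have FD : is_derive t 1 F (f t) := DeriveDef dF (etrans (esym (derive1E F t)) FE).
apply: (@near_eq_is_derive _ _ _ (cst c + F)).
  near=> s; rewrite gE//.
  have : 0 < s < T by near: s; exact: near_itvoo.
  by case/andP=> /ltW -> /ltW ->.
by rewrite -[f t]add0r; exact: is_deriveD.
Unshelve. all: by end_near. Qed.

Lemma continuous_integrable (f : R -> R) (a b : R) :
  {within `[a, b], continuous f} ->
  lebesgue_measure.-integrable `[a, b] (EFin \o f).
Proof. by apply: continuous_compact_integrable; exact: segment_compact. Qed.

Lemma Rintegral_lincomb n (c : 'I_n -> R) (f : 'I_n -> R -> R)
    (D : set (measurableTypeR R)) : measurable D ->
  (forall i, lebesgue_measure.-integrable D (EFin \o f i)) ->
  lebesgue_measure.-integrable D (EFin \o (fun t => \sum_i c i * f i t)) /\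
  Rintegral lebesgue_measure D (fun t => \sum_i c i * f i t) =
    \sum_i c i * Rintegral lebesgue_measure D (f i).
Proof.
move=> mD; elim: n c f => [|n IH] c f intf.
  rewrite big_ord0; under [X in _ /\ Rintegral _ _ X = _]eq_fun do rewrite big_ord0.
  split; last by rewrite Rintegral_cst// mul0r.
  by under eq_fun do rewrite /= big_ord0; exact: integrable0.
have [IH1 IH2] := IH (c \o widen_ord (leqnSn n)) (f \o widen_ord (leqnSn n))
                  (fun i => intf _).
have intl : lebesgue_measure.-integrable D (EFin \o (fun t => c ord_max * f ord_max t)).
  exact: (integrableZl mD (c ord_max) (intf ord_max)).
rewrite big_ord_recr /=.
rewrite (_ : (fun t => _) = fun t =>
    \sum_(i < n) (c \o widen_ord (leqnSn n)) i * (f \o widen_ord (leqnSn n)) i t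
    + c ord_max * f ord_max t); last by apply/funext => t; rewrite big_ord_recr.
split; first exact: (integrableD mD IH1 intl).
by rewrite RintegralD// IH2 RintegralZl.
Qed.

(** The rows [p^T A^k] span a space stable under right multiplication by [A], by
    the Cayley-Hamilton theorem; a matrix [W] of generators then intertwines [A]
    with some [M]. *)
Lemma krylov_stable n (A : 'M[R]_n) (p : 'cV[R]_n) :
  exists W M : 'M[R]_n, [/\ W *m A = M *m W, exists c, p^T = c *m W &
    forall i, exists k, row i W = (iter k (mulmx A^T) p)^T].
Proof.
case: n A p => [|n] A p.
  exists 0, 0; split; first by rewrite mul0mx mulmx0.
    by exists 0; apply/matrixP => i j; case: j.
  by case.
pose W : 'M[R]_n.+1 := \matrix_(i < n.+1) (iter i (mulmx A^T) p)^T.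
have iterE k : iter k (mulmx A^T) p = (A ^+ k)^T *m p.
  elim: k => [|k IH]; first by rewrite expr0 trmx1 mul1mx.
  by rewrite iterS IH mulmxA -trmx_mul mulmxE -exprSr.
have rowO i : row i W = p^T *m A ^+ i by rewrite rowK iterE trmx_mul trmxK.
have /submxP[M MO] : (W *m A <= W)%MS.
  apply/row_subP => i; rewrite row_mul rowO -mulmxA mulmxE -exprSr.
  have [lin|] := ltnP i.+1 n.+1.
    by rewrite -(rowO (Ordinal lin)) row_sub.
  rewrite ltnS leq_eqVlt ltnNge -ltnS ltn_ord orbF => /eqP <-.
  (* For the last row, the relation given by the characteristic polynomial is
     solved for the top power, whose coefficient is 1. *)
  pose c := char_poly A.
  have : horner_mx A c = 0 by exact: Cayley_Hamilton.
  rewrite -[c]coefK poly_def rmorph_sum size_char_poly big_ord_recr /=.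
  have -> : c`_n.+1 = 1.
    by have /monicP := char_poly_monic A; rewrite /lead_coef size_char_poly.
  rewrite scale1r rmorphXn /= horner_mx_X => /eqP.
  rewrite addrC addr_eq0 => /eqP ->; rewrite mulmxN -mulNmx mulmx_sumr.
  apply: summx_sub => j _; rewrite linearZ /= rmorphXn /= horner_mx_X.
  by rewrite -scalemxAr mulNmx -rowO scalemx_sub// eqmx_opp row_sub.
exists W, M; split => //; last by move=> i; exists i; rewrite rowK.
by exists (delta_mx 0 ord0); rewrite -rowE rowO expr0 mulmx1.
Qed.

(** If [p] is annihilated by all [B^T (A^T)^k], then [W x] solves an equation in
    which the control does not appear, so a transfer starting at 0 keeps [W x] at
    0; applying this to a transfer from 0 to [p] forces [p = 0]. *)
Lemma controllable_kalman n m (A : 'M[R]_n) (B : 'M[R]_(n, m)) :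
  controllable A B -> kalman A B.
Proof.
move=> ctr p pB.
have [W [M [WA [c pc] rowO]]] := krylov_stable A p.
have WB : W *m B = 0.
  apply/row_matrixP => i; rewrite row_mul row0; have [k ->] := rowO i.
  by rewrite -[B]trmxK -trmx_mul pB trmx0.
have [T [T0 [u [x [_ xP xT]]]]] := ctr 0 p.
pose y t := W *m x t.
have yE t i : 0 <= t <= T ->
    y t i 0 = 0 + Rintegral lebesgue_measure `[0, t] (fun s => (M *m y s) i 0).
  move=> t0T; rewrite add0r mxE.
  rewrite (eq_bigr (fun j => W i j * Rintegral lebesgue_measure `[0, t]
     (fun s => (A *m x s + B *m u s) j 0))); last first.
    by move=> j _; have [_ ->//] := xP j; rewrite mxE add0r.
  rewrite -(Rintegral_lincomb _ _ _).2//; last first.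
    move=> j; case: (xP j) => + _; apply: integrableS => //.
    by apply: subset_itvl; case/andP: t0T.
  apply: eq_Rintegral => s _; rewrite /y mulmxA -WA -mulmxA.
  rewrite -[W *m _]addr0 -(mul0mx _ (u s)) -WB -mulmxA -mulmxDr.
  by rewrite mxE.
have xc : vcont 0 T x.
  move=> i; have [intx xE] := xP i.
  exact: (@integral_eq_continuous (fun s => (A *m x s + B *m u s) i 0) (fun t => x t i 0) _ T (ltW T0) intx xE).
have yc : vcont 0 T y by exact: vcont_mulmx.
have Myc : vcont 0 T (fun s => M *m y s) by exact: vcont_mulmx.
have y0 : y 0 = 0.
  apply/matrixP => i j; rewrite ord1 yE ?lexx ?(ltW T0)// add0r set_itv1.
  by rewrite Rintegral_set1 mxE.
have yT : y T = 0.
  apply: (linear_ode_unique yc _ (s := 0)) => //; rewrite ?lexx ?ltW//.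
  move=> t tT i.
  apply: (@integral_eq_derive (fun s => (M *m y s) i 0) (fun s => y s i 0) 0 T) => //.
    exact: continuous_integrable.
  by move=> s; exact: yE.
have Wp : W *m p = 0 by rewrite -xT.
by apply: dot_le0; rewrite dot_mx pc -mulmxA Wp mulmx0 mxE.
Qed.

End Kalman.

(** * Lyapunov forms of matrices without imaginary eigenvalues *)

Section RealSchur.
Variable R : realType.
Local Open Scope complex_scope.
Local Notation Re := (@complex.Re R).
Local Notation Im := (@complex.Im R).
Local Notation cplx := (map_mx (real_complex R)).

Lemma Re_mul x y : Re (x * y) = Re x * Re y - Im x * Im y.
Proof. by case: x; case: y. Qed.

Lemma Im_mul x y : Im (x * y) = Re x * Im y + Im x * Re y.
Proof. by case: x => ? ?; case: y. Qed.

Lemma Re_sum (I : finType) (F : I -> R[i]) : Re (\sum_i F i) = \sum_i Re (F i).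
Proof. by apply: (big_morph Re) => // -[? ?] [? ?]. Qed.

Lemma Im_sum (I : finType) (F : I -> R[i]) : Im (\sum_i F i) = \sum_i Im (F i).
Proof. by apply: (big_morph Im) => // -[? ?] [? ?]. Qed.

Lemma Re_mulmx k l m (M : 'M[R[i]]_(k, l)) (N : 'M[R[i]]_(l, m)) :
  map_mx Re (M *m N) = map_mx Re M *m map_mx Re N - map_mx Im M *m map_mx Im N.
Proof.
apply/matrixP => i j; rewrite !mxE Re_sum -sumrB.
by apply: eq_bigr => p _; rewrite !mxE Re_mul.
Qed.

Lemma Im_mulmx k l m (M : 'M[R[i]]_(k, l)) (N : 'M[R[i]]_(l, m)) :
  map_mx Im (M *m N) = map_mx Re M *m map_mx Im N + map_mx Im M *m map_mx Re N.
Proof.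
apply/matrixP => i j; rewrite !mxE Im_sum -big_split.
by apply: eq_bigr => p _; rewrite !mxE Im_mul.
Qed.

Lemma Re_cplx k l (M : 'M[R]_(k, l)) : map_mx Re (cplx M) = M.
Proof. by apply/matrixP => i j; rewrite !mxE. Qed.

Lemma Im_cplx k l (M : 'M[R]_(k, l)) : map_mx Im (cplx M) = 0.
Proof. by apply/matrixP => i j; rewrite !mxE. Qed.

Lemma eq_ReIm k l (M N : 'M[R[i]]_(k, l)) :
  map_mx Re M = map_mx Re N -> map_mx Im M = map_mx Im N -> M = N.
Proof.
move=> /matrixP r /matrixP s; apply/matrixP => i j.
by have := r i j; have := s i j; rewrite !mxE; case: (M i j) (N i j) => ? ? [? ?] /= -> ->.
Qed.

(** Real and imaginary parts of a complex Schur triangularization: with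
    [W = W1 + i W2] unitary and [T = T1 + i T2] lower triangular, the first two
    equations are [W H = T W], and the third is the real part of [W^* W = 1]. *)
Lemma real_schur k (H : 'M[R]_k) : exists W1 W2 T1 T2 : 'M[R]_k,
  [/\ W1 *m H = T1 *m W1 - T2 *m W2, W2 *m H = T1 *m W2 + T2 *m W1,
      W1^T *m W1 + W2^T *m W2 = 1%:M,
      forall i j : 'I_k, (i < j)%N -> T1 i j = 0 /\ T2 i j = 0 &
      forall i, eigenvalue (cplx H) (T1 i i +i* T2 i i)%C].
Proof.
case: k H => [|k] H.
  by exists 0, 0, 0, 0; split; try (by apply/matrixP => -[]); case.
have [P Pu] := Schur (cplx H) (ltn0Sn k).
set U := conjmx P (cplx H) => Ut; have {}Ut : is_trig_mx U by [].
have UE : U = P *m cplx H *m invmx P by rewrite /U conjymx// invmx_unitary.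
clearbody U; have Punit := unitarymx_unit Pu.
have PH : P *m cplx H = U *m P by rewrite UE mulmxKV.
exists (map_mx Re P), (map_mx Im P), (map_mx Re U), (map_mx Im U); split.
- have := congr1 (map_mx Re) PH; rewrite !Re_mulmx Re_cplx Im_cplx.
  by rewrite mulmx0 subr0.
- have := congr1 (map_mx Im) PH; rewrite !Im_mulmx Re_cplx Im_cplx.
  by rewrite mulmx0 add0r.
- have /mulmx1C/matrixP PP := unitarymxP Pu.
  apply/matrixP => i j; have := congr1 Re (PP i j); rewrite !mxE Re_sum => E.
  transitivity (Re (i == j)%:R); last by case: (i == j).
  rewrite -E -big_split; apply: eq_bigr => l _; rewrite !mxE Re_mul /=.
  by case: (P l i) => a b; case: (P l j) => c d /=; rewrite mulNr opprK.
- by move=> i j ij; rewrite !mxE; have /is_trig_mxP -> := Ut.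
move=> i; rewrite !mxE (_ : (_ +i* _)%C = U i i); last by case: (U i i).
have : eigenvalue U (U i i).
  rewrite eigenvalue_root_char char_poly_trig// (bigD1 i)//=.
  by rewrite rootM root_XsubC eqxx.
move=> /eigenvalueP[v vU v0]; apply/eigenvalueP; exists (v *m P).
  by rewrite -mulmxA PH mulmxA vU scalemxAl.
apply: contra v0 => /eqP vP; rewrite -[v](mulmxK Punit) vP.
by rewrite mul0mx.
Qed.

(** An off-diagonal entry of a triangular matrix contributes to the Lyapunov
    derivative a product of two coordinates.  Its weight [d] is at most [h] times
    the geometric mean [E * F] of the diagonal weights [E ^ 2] and [F ^ 2], so the
    Cauchy-Schwarz inequality makes it a fraction [h] of the diagonal part [Z]. *)
Lemma cross_term_bound (h E F p q r s t1 t2 d Z : R) :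
  0 <= h -> 0 <= E -> 0 <= F -> `|d| <= h * (E * F) ->
  E * E * (p ^+ 2 + q ^+ 2) <= Z -> F * F * (r ^+ 2 + s ^+ 2) <= Z ->
  d * (p * (t1 * r - t2 * s) + q * (t1 * s + t2 * r)) <= (`|t1| + `|t2|) * (h * Z).
Proof.
move=> h0 E0 F0 dh EZ FZ.
have half x y : E * F * `|p * x + q * y| <= (E * E * (p ^+ 2 + q ^+ 2)
    + F * F * (x ^+ 2 + y ^+ 2)) / 2.
  rewrite -[E * F]ger0_norm ?mulr_ge0// -normrM ler_norml.
  have := sqr_ge0 (E * p + F * x); have := sqr_ge0 (E * q + F * y).
  have := sqr_ge0 (E * p - F * x); have := sqr_ge0 (E * q - F * y).
  rewrite !expr2 => ? ? ? ?; apply/andP; split; lra.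
have rs : E * F * `|p * r + q * s| <= Z.
  by apply: le_trans (half r s) _; rewrite ler_pdivrMr//; lra.
have sr : E * F * `|p * - s + q * r| <= Z.
  apply: le_trans (half (- s) r) _; rewrite sqrrN (addrC (s ^+ 2)) ler_pdivrMr//.
  lra.
rewrite (_ : _ * _ = d * (t1 * (p * r + q * s) + t2 * (p * - s + q * r))); last by ring.
have dd : `|d| * (`|t1| * `|p * r + q * s| + `|t2| * `|p * - s + q * r|) <=
    (`|t1| + `|t2|) * (h * Z).
  apply: (@le_trans _ _ (h * (`|t1| * (E * F * `|p * r + q * s|)
                            + `|t2| * (E * F * `|p * - s + q * r|)))).
    rewrite [leRHS](_ : _ = h * (E * F) * (`|t1| * `|p * r + q * s|
                            + `|t2| * `|p * - s + q * r|)); last by ring.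
    by rewrite ler_wpM2r// addr_ge0// mulr_ge0.
  by rewrite [leRHS]mulrCA ler_wpM2l// mulrDl lerD// ler_wpM2l.
apply: le_trans (ler_norm _) _; rewrite normrM; apply: le_trans dd.
by rewrite ler_wpM2l// (le_trans (ler_normD _ _))// !normrM.
Qed.

(** In Schur coordinates [a + i b = W w], take the diagonal form with weights
    [- sg (Re T i i) * eta ^ (2 i)].  The diagonal of [T] then contributes
    [- |Re T i i|] times the weights, and rapidly decreasing weights make the
    strictly lower triangular part negligible. *)
Lemma lyapunov_form k (H : 'M[R]_k) :
  (forall b, ~~ eigenvalue (cplx H) (0 +i* b)%C) ->
  exists2 S : 'M[R]_k, S^T = S &
    exists2 c : R, 0 < c & forall w, dot w (S *m (H *m w)) <= - c * dot w w.
Proof.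
move=> nimag; have [W1 [W2 [T1 [T2 [W1H W2H WW trig eig]]]]] := real_schur H.
have T1n0 i : T1 i i != 0.
  by apply: contraNneq (nimag (T2 i i)) => T1i; rewrite -T1i.
(* The inverse of a sum that dominates every [`|T1 i i|^-1] is a positive lower
   bound for all [`|T1 i i|]. *)
pose rho : R := (1 + \sum_i `|T1 i i|^-1)^-1.
have rho0 : 0 < rho.
  by rewrite invr_gt0 ltr_pwDl// sumr_ge0// => i _; rewrite invr_ge0.
have rhoP i : rho <= `|T1 i i|.
  have T0 : 0 < `|T1 i i| by rewrite normr_gt0.
  rewrite /rho invf_ple ?posrE//; last by rewrite -invr_gt0.
  rewrite (bigD1 i)//= addrCA lerDl; apply: addr_ge0 => //.
  by apply: sumr_ge0 => j _; rewrite invr_ge0.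
pose M : R := \sum_i \sum_j (`|T1 i j| + `|T2 i j|).
have M0 : 0 <= M by do 2 (apply: sumr_ge0 => ? _); rewrite addr_ge0.
(* The choice of [eta] makes [eta * M], the total of the cross terms, at most
   half of the diagonal gain [rho]. *)
pose eta : R := rho / (2 * (M + rho)).
have den0 : 0 < 2 * (M + rho) by rewrite mulr_gt0// ltr_wpDl.
have eta0 : 0 < eta by rewrite divr_gt0.
have eta1 : eta <= 1 by rewrite ler_pdivrMr// mul1r; lra.
have etaM : eta * M <= rho / 2 by rewrite /eta mulrAC ler_pdivrMr//; nra.
pose d i : R := - Num.sg (T1 i i) * eta ^+ (i + i).
pose D := \matrix_(i < k, j < k) (d i *+ (i == j)).
have DT : D^T = D by apply/matrixP => i j; rewrite !mxE eq_sym; case: eqP => // ->.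
have dotD u v : dot u (D *m v) = \sum_i d i * (u i 0 * v i 0).
  apply: eq_bigr => i _; rewrite mxE (bigD1 i)//= big1 ?addr0; last first.
    by move=> j ji; rewrite mxE eq_sym (negbTE ji) mulr0n mul0r.
  by rewrite mxE eqxx mulr1n mulrCA.
exists (W1^T *m D *m W1 + W2^T *m D *m W2).
  by rewrite linearD /= !trmx_mul !trmxK DT !mulmxA.
exists (rho / 2 * eta ^+ (k + k)); first by rewrite mulr_gt0 ?divr_gt0 ?exprn_gt0.
move=> w; pose a := W1 *m w; pose b := W2 *m w.
have -> : dot w w = \sum_i (a i 0 ^+ 2 + b i 0 ^+ 2).
  rewrite -[X in dot _ X]mul1mx -WW mulmxDl dotDr -!mulmxA -!dot_mulmxl.
  by rewrite -big_split; apply: eq_bigr => i _; rewrite -!expr2.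
have -> : dot w ((W1^T *m D *m W1 + W2^T *m D *m W2) *m (H *m w)) =
    \sum_i \sum_j d i * (a i 0 * (T1 i j * a j 0 - T2 i j * b j 0)
                       + b i 0 * (T1 i j * b j 0 + T2 i j * a j 0)).
  rewrite mulmxDl dotDr -!mulmxA -!dot_mulmxl !dotD.
  rewrite (mulmxA W1) (mulmxA W2) W1H W2H !mulmxDl mulNmx -!mulmxA -/a -/b.
  rewrite -big_split; apply: eq_bigr => i _ /=.
  rewrite !mxE -sumrN -!big_split /= !mulr_sumr -big_split /=.
  by apply: eq_bigr => j _; ring.
pose z (i : 'I_k) := eta ^+ (i + i) * (a i 0 ^+ 2 + b i 0 ^+ 2).
pose Z := \sum_i z i.
have z0 i : 0 <= z i by rewrite mulr_ge0 ?exprn_ge0 ?(ltW eta0)// addr_ge0 ?sqr_ge0.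
have Z0 : 0 <= Z by exact: sumr_ge0.
have zZ i : z i <= Z by rewrite /Z (bigD1 i)//= lerDl sumr_ge0.
have term (i j : 'I_k) : d i * (a i 0 * (T1 i j * a j 0 - T2 i j * b j 0)
                     + b i 0 * (T1 i j * b j 0 + T2 i j * a j 0))
    <= (if j == i then - rho * z i else 0) + (`|T1 i j| + `|T2 i j|) * (eta * Z).
  have rest0 : 0 <= (`|T1 i j| + `|T2 i j|) * (eta * Z).
    by apply: mulr_ge0; [exact: addr_ge0|rewrite mulr_ge0// ltW].
  case: (ltngtP i j) => [ij|ji|/val_inj ij].
  - have [-> ->] := trig i j ij; case: eqP => [jE|_].
      by rewrite jE ltnn in ij.
    by rewrite normr0 !(mul0r, addr0, subrr, mulr0).
  - have -> : (j == i) = false by apply/negbTE; rewrite -val_eqE neq_ltn ji.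
    rewrite add0r; apply: (@cross_term_bound eta (eta ^+ i) (eta ^+ j)).
    + exact: ltW.
    + by rewrite exprn_ge0// ltW.
    + by rewrite exprn_ge0// ltW.
    + rewrite normrM normrN normr_sg T1n0 mul1r ger0_norm ?exprn_ge0 ?(ltW eta0)//.
      rewrite -exprD -exprS; apply: ler_wiXn2l; rewrite ?(ltW eta0)//.
      by rewrite -addnS leq_add2l.
    + by rewrite -expr2 -exprM mulnC mul2n -addnn; exact: zZ.
    + by rewrite -expr2 -exprM mulnC mul2n -addnn; exact: zZ.
  - move: rest0; rewrite -ij eqxx => rest0.
    apply: (@le_trans _ _ (- rho * z i)); last by rewrite lerDl.
    rewrite (_ : _ * _ = - (Num.sg (T1 i i) * T1 i i * z i)); last first.
      by rewrite /d /z; ring.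
    by rewrite mulNr lerN2 ler_wpM2r// -normrEsg.
apply: (@le_trans _ _ (- (rho / 2) * Z)).
  apply: (@le_trans _ _ (- rho * Z + M * (eta * Z))).
    have -> : - rho * Z = \sum_i - rho * z i by rewrite mulr_sumr.
    rewrite /M mulr_suml -big_split /=; apply: ler_sum => i _.
    rewrite mulr_suml [X in X + _](_ : _ = \sum_j if j == i then - rho * z i else 0).
      by rewrite -big_split /=; apply: ler_sum => j _; exact: term.
    by rewrite -big_mkcond big_pred1_eq.
  by rewrite mulrA (mulrC M) -mulrDl ler_wpM2r//; lra.
rewrite !mulNr lerN2 -[leLHS]mulrA ler_wpM2l ?divr_ge0 ?(ltW rho0)//.
rewrite mulr_sumr; apply: ler_sum => i _; rewrite ler_wpM2r ?addr_ge0 ?sqr_ge0//.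
by apply: ler_wiXn2l; rewrite ?(ltW eta0)// leq_add// ltnW.
Qed.

End RealSchur.

(** * Decay along a Lyapunov form *)

Section Decay.
Variable R : realType.

Definition ode_sol k (H : 'M[R]_k) (w : R -> 'cV[R]_k) :=
  forall t, has_deriv w t (H *m w t).

Lemma ode_sol_cont k (H : 'M[R]_k) w a b : ode_sol H w -> vcont a b w.
Proof. exact: has_deriv_vcont. Qed.

Lemma flow_sol k (H : 'M[R]_k) (E : R -> 'M[R]_k) (w0 : 'cV[R]_k) :
  (forall (t : R) i j, is_derive t 1 (fun s => E s i j : R) ((H *m E t) i j)) ->
  ode_sol H (fun t => E t *m w0).
Proof.
move=> dE t i.
rewrite (_ : (fun s => _) = \sum_j (w0 j 0 \*: (fun s => E s i j))); last first.
  apply/funext => s; rewrite mxE fct_sumE; apply: eq_bigr => j _.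
  by rewrite mulrC.
rewrite mulmxA [X in is_derive _ _ _ X]mxE.
rewrite (eq_bigr (fun j => w0 j 0 *: ((H *m E t) i j : R))); last first.
  by move=> j _; rewrite mulrC.
by apply: is_derive_sum => j; apply: is_deriveZ; exact: dE.
Qed.

Lemma flow_eq k (H : 'M[R]_k) (E : R -> 'M[R]_k) (w : R -> 'cV[R]_k) t :
  E 0 = 1%:M ->
  (forall (t : R) i j, is_derive t 1 (fun s => E s i j : R) ((H *m E t) i j)) ->
  ode_sol H w -> 0 <= t -> w t = E t *m w 0.
Proof.
move=> E0 dE sw t0; apply/eqP; rewrite -subr_eq0; apply/eqP.
pose v s := w s - E s *m w 0.
have sv : ode_sol H v.
  move=> s; rewrite /v mulmxBr; apply: has_derivD; first exact: sw.
  by apply: has_derivN; exact: (flow_sol _ dE).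
change (v t = 0); apply: (linear_ode_unique (ode_sol_cont (a := 0) (b := t) sv) (fun s _ => sv s) (s := 0)) => //.
- by rewrite lexx t0.
- by rewrite lexx t0.
- by rewrite /v E0 mul1mx subrr.
Qed.

(** Since [V' <= - 2 c |w|^2] and
    [|V| <= s |w|^2], the indefinite form satisfies [V' <= - a |V|] with
    [a = 2 c / s]; this gives an upper bound for [V] that decays from 0 and a
    lower bound that decays from [T].  A point of a unit window around [t] where
    [- V'] equals the drop of [V] has small [|w|^2], and [linear_growth]
    transfers this to [t]. *)
Lemma solution_decay k (H : 'M[R]_k) :
  (forall b, ~~ eigenvalue (map_mx (real_complex R) H) (Complex 0 b)) ->
  exists K a : R, [/\ 0 < K, 0 < a & forall (T : R) w, 1 <= T -> ode_sol H w ->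
    forall t : R, 0 <= t <= T -> dot (w t) (w t) <=
      K * (expR (- a * t) + expR (- a * (T - t))) *
      (dot (w 0) (w 0) + dot (w T) (w T))].
Proof.
move=> /lyapunov_form[S ST [c c0 SP]].
have [s s0 sP] := dot_bound S.
have [h h0 hP] := linear_growth H.
pose a : R := 2 * c / s.
have a0 : 0 < a by rewrite divr_gt0// mulr_gt0.
exists (expR h * (expR a * s / (2 * c))), a; split => //.
  by rewrite !mulr_gt0 ?expR_gt0// invr_gt0 mulr_gt0.
move=> T w T1 sw t /andP[t0 tT].
pose V r := dot (w r) (S *m w r).
pose dV r := 2 * dot (w r) (S *m (H *m w r)).
have dVP (r : R) : is_derive r 1 V (dV r).
  apply: is_derive_eq.
    by apply: is_derive_dot; [exact: sw|apply: has_deriv_mulmx; exact: sw].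
  by rewrite dot_mulmxr ST dotC /dV mulr_natl.
have cV (x y : R) : {within `[x, y], continuous V}.
  by apply: derivable_within_continuous => r _; have [] := dVP r.
have Vs r : `|V r| <= s * dot (w r) (w r) := sP (w r).
have dVs r : dV r <= - (2 * c) * dot (w r) (w r).
  by rewrite /dV mulNr -mulrA -mulrN -mulNr ler_wpM2l.
have as_ : a * s = 2 * c by rewrite /a mulfVK// gt_eqF.
pose N := dot (w 0) (w 0) + dot (w T) (w T).
have T0 : 0 <= T by rewrite (le_trans _ T1).
have N0 : 0 <= N by rewrite addr_ge0 ?dot_ge0.
have up r : 0 <= r -> r <= T -> V r <= expR (- a * r) * (s * N).
  move=> r0 rT.
  have mono : expR (a * r) * V r <= expR (a * 0) * V 0.
    apply: (@gronwall _ V dV a 0 T (fun x _ => dVP x) _ (cV 0 T)) => // x _.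
    have := dVs x; have := ler_wpM2l (ltW a0) (le_trans (ler_norm _) (Vs x)).
    by rewrite mulrA as_; lra.
  rewrite mulNr expRN mulrC ler_pdivlMr ?expR_gt0// mulrC.
  apply: le_trans mono _; rewrite mulr0 expR0 mul1r.
  apply: le_trans (ler_norm _) _; apply: le_trans (Vs 0) _.
  by rewrite ler_wpM2l ?(ltW s0)// lerDl dot_ge0.
have dn r : 0 <= r -> r <= T -> - V r <= expR (- a * (T - r)) * (s * N).
  move=> r0 rT.
  have mono : expR (- a * T) * V T <= expR (- a * r) * V r.
    apply: (@gronwall _ V dV (- a) 0 T (fun x _ => dVP x) _ (cV 0 T)) => // x _.
    have := Vs x; rewrite ler_norml => /andP[Vx _].
    by have := dVs x; have := ler_wpM2l (ltW a0) Vx; rewrite mulrN mulrA as_; lra.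
  rewrite -(ler_pM2l (expR_gt0 (- a * r))) mulrN [leRHS]mulrA -expRD -mulrDr.
  rewrite addrC subrK; apply: (@le_trans _ _ (- (expR (- a * T) * V T))).
    by rewrite lerN2.
  rewrite -mulrN ler_wpM2l ?expR_ge0//.
  apply: le_trans (ler_norm _) _; rewrite normrN; apply: le_trans (Vs T) _.
  by rewrite ler_wpM2l ?(ltW s0)// lerDr dot_ge0.
(* The window [r, r + 1] contains [t] and stays inside [0, T]. *)
pose r := Num.min t (T - 1).
have r0 : 0 <= r by rewrite le_min t0 subr_ge0.
have rt : r <= t by rewrite ge_min lexx.
have rT : r + 1 <= T by rewrite -lerBrDr ge_min lexx orbT.
have tr : t <= r + 1.
  by rewrite /r; case: (leP t (T - 1)) => _; [rewrite lerDl|rewrite subrK].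
have r1 : r < r + 1 by rewrite ltrDl.
have [x] := MVT r1 (fun x _ => dVP x) (cV r (r + 1)).
rewrite in_itv/= addrAC subrr add0r mulr1 => /andP[rx xr] VE.
have r1T : r <= T by rewrite (le_trans _ rT)// ltW.
have drop : 2 * c * dot (w x) (w x) <=
    (expR (- a * r) + expR (- a * (T - (r + 1)))) * (s * N).
  have := dVs x; have := up r r0 r1T.
  have := dn (r + 1) (le_trans r0 (ltW r1)) rT; move: VE.
  by rewrite mulrDl; lra.
have grow : dot (w t) (w t) <= expR h * dot (w x) (w x).
  have /= := hP w r (r + 1) (ode_sol_cont sw) (fun u _ => sw u) x t.
  rewrite rt tr (ltW rx) (ltW xr) => /(_ isT isT) gr.
  apply: le_trans gr _; rewrite ler_wpM2r ?dot_ge0// ler_expR.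
  rewrite ger_pMr// ler_norml; apply/andP; split; lra.
have exps : expR (- a * r) + expR (- a * (T - (r + 1))) <=
    expR a * (expR (- a * t) + expR (- a * (T - t))).
  rewrite [leRHS]mulrDr -!expRD lerD// ler_expR.
    have := ler_wpM2l (ltW a0) tr; lra.
  have := ler_wpM2l (ltW a0) rt; lra.
apply: le_trans grow _; rewrite -!mulrA ler_wpM2l ?expR_ge0//.
rewrite -(ler_pM2l (_ : 0 < 2 * c)) ?mulr_gt0//; apply: le_trans drop _.
rewrite [leRHS](_ : _ = expR a * (expR (- a * t) + expR (- a * (T - t))) * (s * N)).
  by rewrite ler_wpM2r// mulr_ge0// ltW.
rewrite -/N; field.
by rewrite gt_eqF.
Qed.

(** An explicit constant is 1 plus the trace of the inverse of [S]: with
    [S b_i = e_i], the Cauchy-Schwarz inequality for the form [S] bounds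
    [w_i ^ 2 = (S b_i | w) ^ 2] by [(b_i | S b_i) (w | S w)]. *)
Lemma coercive_form k (S : 'M[R]_k) : S^T = S ->
  (forall w, dot w (S *m w) <= 0 -> w = 0) ->
  exists2 c : R, 0 < c & forall w, dot w w <= c * dot w (S *m w).
Proof.
move=> ST Spos.
have Sunit : S \in unitmx.
  by apply: mx_inj_unit => w Sw; apply: Spos; rewrite Sw dot0r.
pose b i : 'cV[R]_k := invmx S *m delta_mx i 0.
have Sb i : S *m b i = delta_mx i 0 by rewrite mulmxA mulmxV// mul1mx.
have dote (w : 'cV[R]_k) i : dot w (delta_mx i 0) = w i 0.
  rewrite /dot (bigD1 i)//= mxE !eqxx mulr1 big1 ?addr0// => j ji.
  by rewrite mxE (negbTE ji) mulr0.
have Qpos w : 0 <= dot w (S *m w).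
  have [/Spos -> | /ltW//] := leP (dot w (S *m w)) 0.
  by rewrite dot0l.
have sig0 i : 0 < b i i 0.
  rewrite ltNge -dote -Sb; apply/negP => /Spos b0.
  have := Sb i; rewrite b0 mulmx0 => /matrixP/(_ i 0); rewrite !mxE !eqxx.
  by move=> /eqP; rewrite eq_sym oner_eq0.
exists (1 + \sum_i b i i 0).
  by rewrite ltr_pwDl// sumr_ge0// => i _; rewrite ltW.
move=> w; rewrite mulrDl mul1r ler_wpDl// mulr_suml; apply: ler_sum => i _.
rewrite -expr2 mulrC -ler_pdivrMr//.
(* The scalar minimizes the form along the line through [w] directed by [b i]. *)
have := Qpos (w - (w i 0 / b i i 0) *: b i).
rewrite mulmxBr -scalemxAr Sb !dotE !dote.
rewrite [dot (b i) (S *m w)]dot_mulmxr ST Sb [dot (delta_mx _ _) _]dotC dote.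
set x := w i 0; set y := b i i 0 => H; rewrite -subr_ge0; apply: le_trans H _.
rewrite le_eqVlt; apply/orP; left; apply/eqP; field.
exact: lt0r_neq0 (sig0 i).
Qed.

End Decay.

(** * The Hamiltonian system and its observability *)

Section Hamiltonian.
Variable R : realType.

Definition ham n m p (A : 'M[R]_n) (B : 'M[R]_(n, m)) (C : 'M[R]_(p, n)) :
    'M[R]_(n + n) :=
  block_mx A (- (B *m B^T)) (- (C^T *m C)) (- A^T).

Lemma ham_mul n m p (A : 'M[R]_n) (B : 'M[R]_(n, m)) (C : 'M[R]_(p, n))
    (w : 'cV[R]_(n + n)) :
  ham A B C *m w =
  col_mx (A *m usubmx w - B *m (B^T *m dsubmx w))
         (- (C^T *m (C *m usubmx w)) - A^T *m dsubmx w).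
Proof.
by rewrite -{1}[w]vsubmxK mul_block_col !mulNmx -!mulmxA.
Qed.

Section Solutions.
Variables (n m p : nat) (A : 'M[R]_n) (B : 'M[R]_(n, m)) (C : 'M[R]_(p, n)).
Local Notation H := (ham A B C).
Local Notation y w := (fun t => usubmx (w t)).
Local Notation q w := (fun t => dsubmx (w t)).

Lemma has_deriv_state w t : ode_sol H w ->
  has_deriv (y w) t (A *m usubmx (w t) - B *m (B^T *m dsubmx (w t))).
Proof.
move=> sw i; have := sw t (lshift n i); rewrite ham_mul col_mxEu.
by rewrite (_ : (fun s => w s _ _) = fun s => usubmx (w s) i 0)//;
  apply/funext => s; rewrite mxE.
Qed.

Lemma has_deriv_costate w t : ode_sol H w ->
  has_deriv (q w) t (- (C^T *m (C *m usubmx (w t))) - A^T *m dsubmx (w t)).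
Proof.
move=> sw i; have := sw t (rshift n i); rewrite ham_mul col_mxEd.
by rewrite (_ : (fun s => w s _ _) = fun s => dsubmx (w s) i 0)//;
  apply/funext => s; rewrite mxE.
Qed.

Definition pairing (w : 'cV[R]_(n + n)) := dot (usubmx w) (dsubmx w).

Definition dissipation (w : 'cV[R]_(n + n)) :=
  dot (B^T *m dsubmx w) (B^T *m dsubmx w) + dot (C *m usubmx w) (C *m usubmx w).

Lemma dissipation_ge0 w : 0 <= dissipation w.
Proof. by rewrite addr_ge0 ?dot_ge0. Qed.

(** The skew structure of the Hamiltonian: the terms in [A] cancel, and only the
    two squares survive. *)
Lemma ham_pairing y q :
  dot (A *m y - B *m (B^T *m q)) q + dot y (- (C^T *m (C *m y)) - A^T *m q) =
  - dissipation (col_mx y q).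
Proof.
rewrite /dissipation col_mxKu col_mxKd !dotE.
rewrite (dot_mulmxl A) (dot_mulmxl B) (dot_mulmxr C^T) trmxK; ring.
Qed.

Lemma is_derive_pairing w (t : R) : ode_sol H w ->
  is_derive t 1 (fun s => pairing (w s)) (- dissipation (w t)).
Proof.
move=> sw; apply: is_derive_eq.
  by apply: is_derive_dot; [exact: has_deriv_state|exact: has_deriv_costate].
by rewrite ham_pairing vsubmxK.
Qed.

Lemma pairing_cont w (a b : R) : ode_sol H w ->
  {within `[a, b], continuous (fun s => pairing (w s))}.
Proof.
move=> sw; apply: derivable_within_continuous => t _.
by have [] := is_derive_pairing t sw.
Qed.

Lemma pairing_nincr w (s t : R) : ode_sol H w -> s <= t ->
  pairing (w t) <= pairing (w s).
Proof.
move=> sw st.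
have le0 x : s < x < t -> - dissipation (w x) <= 0.
  by rewrite oppr_le0 dissipation_ge0.
exact: (@derive_le0_ge _ (fun r => pairing (w r)) (fun r => - dissipation (w r))
  s t (fun x _ => is_derive_pairing x sw) le0 (pairing_cont sw) s t).
Qed.

(** Differentiating [B^T q = 0] repeatedly along [q' = - A^T q] annihilates every
    [B^T (A^T)^k q], so the Kalman condition applies. *)
Lemma kalman_unique (q : R -> 'cV[R]_n) (a b : R) : kalman A B ->
  (forall t, a < t < b -> has_deriv q t (- A^T *m q t)) ->
  (forall t, a < t < b -> B^T *m q t = 0) ->
  forall t, a < t < b -> q t = 0.
Proof.
move=> kal dq Bq t tab; apply: kal => k.
elim: k t tab => [|k IH] t tab /=; first exact: Bq.
have mul_iter (v : 'cV[R]_n) : iter k (mulmx A^T) v = iter k (mulmx A^T) 1%:M *m v.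
  by elim: k {IH} => [|k IH]; rewrite /= ?mul1mx// IH mulmxA.
pose f s := (B^T *m iter k (mulmx A^T) 1%:M) *m q s.
have fd : has_deriv f t (B^T *m iter k (mulmx A^T) 1%:M *m (- A^T *m q t)).
  by apply: has_deriv_mulmx; exact: dq.
have f0 : has_deriv f t 0.
  move=> i; apply: (@near_eq_is_derive _ _ _ (cst 0)); last first.
    by rewrite mxE; exact: is_derive_cst.
  near=> s; rewrite /f -mulmxA -mul_iter IH ?mxE//.
  by near: s; exact: near_itvoo.
have : B^T *m iter k (mulmx A^T) 1%:M *m (- A^T *m q t) = 0.
  apply/matrixP => i j; rewrite ord1.
  have := fd i; have := f0 i => -[_ <-] [_ <-] //.
rewrite mulNmx mulmxN -mulmxA -mul_iter -iterSr => /eqP.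
by rewrite oppr_eq0 => /eqP.
Unshelve. all: by end_near. Qed.

(** The right-hand side without [c] is a quadratic form in [w 0], since [w 1] is
    linear in [w 0].  It is positive definite: where it is nonpositive, [y] is 0
    at time 0 and the dissipation vanishes on [0, 1], hence [B^T q = 0] there and
    [kalman_unique] gives [q = 0].  The term in [y] is indispensable because
    [(A, C)] need not be observable. *)
Lemma observability_form : kalman A B -> exists2 c : R, 0 < c &
  forall w, ode_sol H w ->
  dot (w 0) (w 0) <= c * (pairing (w 0) - pairing (w 1)
                         + dot (usubmx (w 0)) (usubmx (w 0))).
Proof.
move=> kal; have [E [E0 dE]] := matrix_flow H.
pose J : 'M[R]_(n + n) := block_mx 0 1%:M 1%:M 0.
pose P : 'M[R]_(n + n) := block_mx 1%:M 0 0 0.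
have JT : J^T = J by rewrite tr_block_mx !trmx0 !trmx1.
have PT : P^T = P by rewrite tr_block_mx !trmx0 !trmx1.
have JE (w : 'cV[R]_(n + n)) : dot w (J *m w) = 2 * pairing w.
  rewrite -{1 2}[w]vsubmxK mul_block_col !mul0mx !mul1mx add0r addr0 dot_col_mx.
  by rewrite [X in _ + X]dotC mulr_natl.
have PE (w : 'cV[R]_(n + n)) : dot w (P *m w) = dot (usubmx w) (usubmx w).
  by rewrite -{1 2}[w]vsubmxK mul_block_col !mul0mx !mul1mx !addr0 dot_col_mx dot0r addr0.
(* The factor 2^-1 compensates [J], which represents twice the pairing. *)
pose S := 2^-1 *: (J - (E 1)^T *m J *m E 1) + P.
have ST : S^T = S.
  by rewrite /S linearD linearZ /= linearB /= PT JT !trmx_mul trmxK JT mulmxA.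
have SE w : dot w (S *m w) =
    pairing w - pairing (E 1 *m w) + dot (usubmx w) (usubmx w).
  rewrite mulmxDl dotDr PE -scalemxAl dotZr mulmxBl dotDr dotNr JE.
  by rewrite -!mulmxA -dot_mulmxl JE; field.
have Spos w0 : dot w0 (S *m w0) <= 0 -> w0 = 0.
  rewrite SE; pose w t := E t *m w0.
  have sw : ode_sol H w by exact: flow_sol.
  have w0E : w 0 = w0 by rewrite /w E0 mul1mx.
  rewrite -{1 3 4}w0E -/(w 1) => le0.
  have mono := pairing_nincr sw (ler01 : 0 <= 1 :> R).
  have y2 := dot_ge0 (usubmx (w 0)).
  have y0 : usubmx (w 0) = 0 by apply: dot_le0; lra.
  have V01 : pairing (w 0) = pairing (w 1) by lra.
  have diss0 (t : R) : 0 < t < 1 -> dissipation (w t) = 0.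
    move=> t01; apply/eqP; rewrite -oppr_eq0; apply/eqP.
    have [_ <-] := is_derive_pairing t sw.
    apply: derive_val; apply: (@near_eq_is_derive _ _ _ (cst (pairing (w 0)))).
      near=> s; have /andP[/ltW s0 /ltW s1] : 0 < s < 1.
        by near: s; exact: near_itvoo.
      apply/esym/le_anti/andP; split; first exact: pairing_nincr sw s0.
      by rewrite /= V01; exact: pairing_nincr sw s1.
  have Bq (t : R) : 0 < t < 1 -> B^T *m dsubmx (w t) = 0.
    move=> /diss0 d; apply: dot_le0; rewrite -d /dissipation.
    by rewrite lerDl dot_ge0.
  have Cy (t : R) : 0 < t < 1 -> C *m usubmx (w t) = 0.
    move=> /diss0 d; apply: dot_le0; rewrite -d /dissipation.
    by rewrite lerDr dot_ge0.
  have dq (t : R) : 0 < t < 1 -> has_deriv (q w) t (- A^T *m dsubmx (w t)).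
    move=> t01; have := has_deriv_costate t sw.
    by rewrite Cy// mulmx0 oppr0 add0r mulNmx.
  have half : 0 < (2^-1 : R) < 1 by rewrite invr_gt0 invf_lt1 ?ltr1n ?ltr0n.
  have qh : dsubmx (w 2^-1) = 0.
    exact: (kalman_unique kal dq Bq half).
  have q0 : dsubmx (w 0) = 0.
    have cq : vcont 0 1 (q w) by apply: has_deriv_vcont => t; exact: has_deriv_costate.
    apply: (linear_ode_unique cq dq (s := 2^-1)) => //.
      by have [/ltW -> /ltW ->] := andP half.
    by rewrite lexx ler01.
  by rewrite -w0E -[w 0]vsubmxK y0 q0 col_mx0.
have [c c0 cP] := coercive_form ST Spos; exists c => // w sw.
by rewrite (flow_eq E0 dE sw ler01) -SE cP.
Unshelve. all: by end_near. Qed.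

End Solutions.

End Hamiltonian.

(** * Two-point boundary values *)

Section BoundaryValues.
Variables (R : realType) (n m p : nat).
Implicit Types (A : 'M[R]_n) (B : 'M[R]_(n, m)) (C : 'M[R]_(p, n)).

Lemma kalmanN A B : kalman A B -> kalman (- A) B.
Proof.
move=> kal v Bv; apply: kal => k; have := Bv k.
have -> : iter k (mulmx (- A)^T) v = (-1) ^+ k *: iter k (mulmx A^T) v.
  elim: k => [|k IH]; first by rewrite expr0 scale1r.
  by rewrite !iterS IH -scalemxAr linearN /= mulNmx exprS mulN1r scaleNr scalerN.
rewrite -scalemxAr => /eqP; rewrite scaler_eq0 signr_eq0 => /eqP//.
Qed.

(** Reversing time and the sign of the costate exchanges [A] and [- A]; this
    transports estimates at the initial time to the final time. *)
Lemma ham_sol_reverse A B C (T : R) w : ode_sol (ham A B C) w ->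
  ode_sol (ham (- A) B C)
    (fun t => col_mx (usubmx (w (T - t))) (- dsubmx (w (T - t)))).
Proof.
move=> sw t; rewrite ham_mul col_mxKu col_mxKd.
have dy := has_deriv_reverse (has_deriv_state (T - t) sw).
have dq := has_derivN (has_deriv_reverse (has_deriv_costate (T - t) sw)).
rewrite (_ : col_mx _ _ = col_mx
  (- (A *m usubmx (w (T - t)) - B *m (B^T *m dsubmx (w (T - t)))))
  (- - (- (C^T *m (C *m usubmx (w (T - t)))) - A^T *m dsubmx (w (T - t))))).
  exact: has_deriv_col_mx.
congr col_mx; first by rewrite mulNmx !mulmxN opprB opprK addrC.
have -> : (- A)^T = - A^T by rewrite linearN.
by rewrite mulNmx mulmxN !opprK.
Qed.

(** Both ends are controlled by the total loss of the pairing on [0, T], each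
    through one unit interval.  The loss is [(y0 | q0) - (yT | qT)], and
    [2 c (y | q) <= |q|^2 + c^2 |y|^2] leaves half of the left-hand side to absorb
    the costates.  The constant does not depend on [T]. *)
Lemma endpoint_bound A B C : kalman A B -> exists2 K : R, 0 < K &
  forall (T : R) w, 1 <= T -> ode_sol (ham A B C) w ->
  dot (w 0) (w 0) + dot (w T) (w T) <=
  K * (dot (usubmx (w 0)) (usubmx (w 0)) + dot (usubmx (w T)) (usubmx (w T))).
Proof.
move=> kal.
have [c1 c10 c1P] := observability_form C kal.
have [c2 c20 c2P] := observability_form C (kalmanN kal).
pose c := c1 + c2; have c0 : 0 < c by rewrite addr_gt0.
exists (2 * c + c ^+ 2); first by rewrite addr_gt0// ?mulr_gt0// exprn_gt0.
move=> T w T1 sw.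
have left_ := c1P w sw.
have := c2P _ (ham_sol_reverse T sw); rewrite /pairing !subr0 !col_mxKu !col_mxKd.
rewrite dot_col_mx !dotE opprK -dot_col_mx vsubmxK -!/(pairing _) => right_.
have T0 : 0 <= T by rewrite (le_trans _ T1).
have m1 := pairing_nincr sw T1.
have m2 := pairing_nincr sw (ler01 : 0 <= 1 :> R).
have m3 : pairing (w T) <= pairing (w (T - 1)).
  by apply: pairing_nincr sw _; rewrite gerBl.
have m4 : pairing (w (T - 1)) <= pairing (w 0).
  by apply: pairing_nincr sw _; rewrite subr_ge0.
move: left_ right_ m1 m2 m3 m4.
set V0 := pairing (w 0); set VT := pairing (w T).
set V1 := pairing (w 1); set VS := pairing (w (T - 1)).
have V0E : 2 * c * V0 <= dot (dsubmx (w 0)) (dsubmx (w 0)) +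
    c ^+ 2 * dot (usubmx (w 0)) (usubmx (w 0)).
  have := dot_ge0 (c *: usubmx (w 0) - dsubmx (w 0)).
  rewrite !dotE -/(pairing _) [dot (dsubmx _) (usubmx _)]dotC -/(pairing _) -/V0.
  lra.
have VTE : - (2 * c * VT) <= dot (dsubmx (w T)) (dsubmx (w T)) +
    c ^+ 2 * dot (usubmx (w T)) (usubmx (w T)).
  have := dot_ge0 (c *: usubmx (w T) + dsubmx (w T)).
  rewrite !dotE -/(pairing _) [dot (dsubmx _) (usubmx _)]dotC -/(pairing _) -/VT.
  lra.
have wE t : dot (w t) (w t) = dot (usubmx (w t)) (usubmx (w t)) +
    dot (dsubmx (w t)) (dsubmx (w t)) by rewrite -dot_col_mx vsubmxK.
have w0E := wE 0; have wTE := wE T.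
have y0 := dot_ge0 (usubmx (w 0)); have yT := dot_ge0 (usubmx (w T)).
move=> left_ right_ m1 m2 m3 m4.
have {}left_ : dot (w 0) (w 0) <=
    c1 * (V0 - VT + dot (usubmx (w 0)) (usubmx (w 0))
                  + dot (usubmx (w T)) (usubmx (w T))).
  by apply: le_trans left_ _; rewrite ler_wpM2l ?(ltW c10)//; lra.
have {}right_ : dot (w T) (w T) <=
    c2 * (V0 - VT + dot (usubmx (w 0)) (usubmx (w 0))
                  + dot (usubmx (w T)) (usubmx (w T))).
  by apply: le_trans right_ _; rewrite ler_wpM2l ?(ltW c20)//; lra.
have : dot (w 0) (w 0) + dot (w T) (w T) <=
    c * (V0 - VT + dot (usubmx (w 0)) (usubmx (w 0))
                  + dot (usubmx (w T)) (usubmx (w T))).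
  by rewrite mulrDl lerD.
lra.
Qed.

(** The map sending an initial costate to the final state, for zero initial
    state, is injective by [endpoint_bound]; being square, it is invertible. *)
Lemma boundary_problem A B C (T : R) (y0 yT : 'cV[R]_n) : kalman A B -> 1 <= T ->
  exists w, [/\ ode_sol (ham A B C) w, usubmx (w 0) = y0 & usubmx (w T) = yT].
Proof.
move=> kal T1; have T0 : 0 <= T by rewrite (le_trans _ T1).
have [K K0 KP] := endpoint_bound C kal.
have [E [E0 dE]] := matrix_flow (ham A B C).
have uE (a b : 'cV[R]_n) : usubmx (E T *m col_mx a b) =
    ulsubmx (E T) *m a + ursubmx (E T) *m b.
  by rewrite -{1}[E T]submxK mul_block_col col_mxKu.
have unit : ursubmx (E T) \in unitmx.
  apply: mx_inj_unit => v Ev.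
  have := KP T _ T1 (flow_sol (col_mx 0 v) dE).
  rewrite E0 mul1mx uE mulmx0 add0r Ev col_mxKu !dot0l addr0 mulr0 => le0.
  have : col_mx 0 v = 0 :> 'cV[R]_(n + n).
    by apply: dot_le0; apply: le_trans le0; rewrite lerDl dot_ge0.
  by rewrite -(col_mx0 _ n n 1) => /eq_col_mx[].
pose q0 := invmx (ursubmx (E T)) *m (yT - ulsubmx (E T) *m y0).
exists (fun t => E t *m col_mx y0 q0); split; first exact: flow_sol.
  by rewrite E0 mul1mx col_mxKu.
by rewrite uE mulmxA mulmxV// mul1mx addrC subrK.
Qed.

End BoundaryValues.

(** * Hyperbolicity of the Hamiltonian and the steady problem *)

Section Hyperbolicity.
Variables (R : realType) (n m p : nat).
Variables (A : 'M[R]_n) (B : 'M[R]_(n, m)) (C : 'M[R]_(p, n)).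
Hypotheses (kal : kalman A B) (hautus : weak_Hautus A C).
Local Notation Re := (@complex.Re R).
Local Notation Im := (@complex.Im R).
Local Notation cplx := (map_mx (real_complex R)).
Local Open Scope complex_scope.

(** Eigenvalues are defined with row vectors; columns are the natural ones for
    the equations at hand. *)
Lemma eigenvalue_colP k (M : 'M[R[i]]_k) (a : R[i]) :
  reflect (exists2 v : 'cV[R[i]]_k, M *m v = a *: v & v != 0) (eigenvalue M a).
Proof.
have ev N : eigenvalue N a = ((N - a%:M)%R \notin unitmx).
  by rewrite /eigenvalue /eigenspace kermx_eq0 row_free_unit.
have -> : eigenvalue M a = eigenvalue M^T a.
  by rewrite !ev -[in LHS]unitmx_tr linearB /= tr_scalar_mx.
apply: (iffP eigenvalueP) => -[v Mv v0]; exists v^T; rewrite ?trmx_eq0//.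
  by apply: trmx_inj; rewrite trmx_mul trmxK Mv linearZ /= trmxK.
by rewrite -trmx_mul Mv linearZ.
Qed.

Lemma Re_imag_scale k (b : R) (v : 'cV[R[i]]_k) :
  map_mx Re ((0 +i* b) *: v) = - b *: map_mx Im v.
Proof. by apply/matrixP => i j; rewrite !mxE Re_mul /= mul0r sub0r mulNr. Qed.

Lemma Im_imag_scale k (b : R) (v : 'cV[R[i]]_k) :
  map_mx Im ((0 +i* b) *: v) = b *: map_mx Re v.
Proof. by apply/matrixP => i j; rewrite !mxE Im_mul /= mul0r add0r. Qed.

Lemma Re_cplx_mul k l (M : 'M[R]_(k, l)) (v : 'cV[R[i]]_l) :
  map_mx Re (cplx M *m v) = M *m map_mx Re v.
Proof. by rewrite Re_mulmx Re_cplx Im_cplx mul0mx subr0. Qed.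

Lemma Im_cplx_mul k l (M : 'M[R]_(k, l)) (v : 'cV[R[i]]_l) :
  map_mx Im (cplx M *m v) = M *m map_mx Im v.
Proof. by rewrite Im_mulmx Re_cplx Im_cplx mul0mx addr0. Qed.

Lemma hautus_kernel (b : R) (x : 'cV[R[i]]_n) :
  cplx A *m x = (0 +i* b) *: x -> cplx C *m x = 0 -> x = 0.
Proof.
move=> Ax Cx; apply/eqP; apply: contraT => x0.
have /hautus rk : eigenvalue (cplx A) (0 +i* b) by apply/eigenvalue_colP; exists x.
have /row_fullP[L LM] : row_full (col_mx (cplx A - (0 +i* b)%:M)%R (cplx C)).
  by rewrite /row_full rk.
case/negP: x0; rewrite -[x]mul1mx -LM -mulmxA mul_col_mx mulmxBl Ax mul_scalar_mx subrr Cx.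
by rewrite col_mx0 mulmx0 eqxx.
Qed.

(** The complex equation [A^T p = - i b p] for [p = p1 + i p2], in real form: the
    plane of [p1] and [p2] is stable under [A^T] and lies in the kernel of
    [B^T]. *)
Lemma kalman_rotation (b : R) (p1 p2 : 'cV[R]_n) :
  A^T *m p1 = b *: p2 -> A^T *m p2 = - b *: p1 ->
  B^T *m p1 = 0 -> B^T *m p2 = 0 -> p1 = 0.
Proof.
move=> Ap1 Ap2 Bp1 Bp2; apply: kal => k.
have [c [d ->]] : exists c d, iter k (mulmx A^T) p1 = c *: p1 + d *: p2.
  elim: k => [|k [c [d IH]]]; first by exists 1, 0; rewrite scale1r scale0r addr0.
  exists (- (d * b)), (c * b).
  rewrite iterS IH mulmxDr -!scalemxAr Ap1 Ap2 !scalerA addrC.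
  by rewrite mulrN.
by rewrite mulmxDr -!scalemxAr Bp1 Bp2 !scaler0 addr0.
Qed.

(** Adding [ham_pairing] for the real and imaginary parts of an eigenvector, the
    contributions of the eigenvalue cancel because it is purely imaginary.  Both
    dissipations then vanish, and the eigenvector equation decouples into one for
    the state, excluded by the Hautus test, and one for the costate, excluded by
    the Kalman condition. *)
Lemma ham_hyperbolic (b : R) : ~~ eigenvalue (cplx (ham A B C)) (0 +i* b).
Proof.
apply/negP => /eigenvalue_colP[v Hv /eqP]; apply.
pose w1 := map_mx Re v; pose w2 := map_mx Im v.
have Hw1 : ham A B C *m w1 = - b *: w2.
  by rewrite -Re_cplx_mul Hv Re_imag_scale.
have Hw2 : ham A B C *m w2 = b *: w1.
  by rewrite -Im_cplx_mul Hv Im_imag_scale.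
move: Hw1 Hw2; rewrite !ham_mul.
set x1 := usubmx w1; set p1 := dsubmx w1; set x2 := usubmx w2; set p2 := dsubmx w2.
rewrite -[w1]vsubmxK -[w2]vsubmxK -/x1 -/x2 -/p1 -/p2 !scale_col_mx.
move=> /eq_col_mx[E1 E2] /eq_col_mx[E3 E4].
have := ham_pairing A B C x1 p1; have := ham_pairing A B C x2 p2.
rewrite E1 E2 E3 E4 /dissipation !col_mxKu !col_mxKd !dotE.
move=> d2 d1.
have := dot_ge0 (B^T *m p1); have := dot_ge0 (B^T *m p2).
have := dot_ge0 (C *m x1); have := dot_ge0 (C *m x2) => c2 c1 b2 b1.
have Bp1 : B^T *m p1 = 0 by apply: dot_le0; lra.
have Bp2 : B^T *m p2 = 0 by apply: dot_le0; lra.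
have Cx1 : C *m x1 = 0 by apply: dot_le0; lra.
have Cx2 : C *m x2 = 0 by apply: dot_le0; lra.
move: E1 E2 E3 E4.
rewrite Bp1 Bp2 Cx1 Cx2 !mulmx0 oppr0 !addr0 !add0r => Ax1 Ap1 Ax2 Ap2.
have {}Ap1 : A^T *m p1 = b *: p2 by rewrite -[LHS]opprK Ap1 scaleNr opprK.
have {}Ap2 : A^T *m p2 = - b *: p1 by rewrite -[LHS]opprK Ap2 scaleNr.
have p10 : p1 = 0 := kalman_rotation Ap1 Ap2 Bp1 Bp2.
have p20 : p2 = 0.
  by apply: (@kalman_rotation (- b) _ p1) => //; rewrite opprK.
have x0 : usubmx v = 0.
  have Rx : map_mx Re (usubmx v) = x1 by rewrite map_usubmx.
  have Ix : map_mx Im (usubmx v) = x2 by rewrite map_usubmx.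
  apply: (@hautus_kernel b).
    apply: eq_ReIm; first by rewrite Re_cplx_mul Re_imag_scale Rx Ix.
    by rewrite Im_cplx_mul Im_imag_scale Rx Ix.
  apply: eq_ReIm; rewrite ?Re_cplx_mul ?Im_cplx_mul ?Rx ?Ix ?Cx1 ?Cx2.
    by apply/matrixP => i j; rewrite !mxE.
  by apply/matrixP => i j; rewrite !mxE.
rewrite -[v]vsubmxK x0 (_ : dsubmx v = 0) ?col_mx0//.
apply: eq_ReIm; rewrite map_dsubmx ?[LHS]p10 ?[LHS]p20.
  by apply/matrixP => i j; rewrite !mxE.
by apply/matrixP => i j; rewrite !mxE.
Qed.

(** The eigenvalue 0 is one of the excluded imaginary ones. *)
Lemma ham_kernel (w : 'cV[R]_(n + n)) : ham A B C *m w = 0 -> w = 0.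
Proof.
move=> Hw; apply/eqP; apply: contraT => w0.
have /negP := ham_hyperbolic 0; case; apply/eigenvalue_colP; exists (cplx w).
  by rewrite -map_mxM Hw map_mx0 (_ : 0 +i* 0 = 0)// scale0r.
apply: contra w0 => /eqP/(congr1 (map_mx Re)); rewrite Re_cplx => ->.
by apply/eqP/matrixP => i j; rewrite !mxE.
Qed.

(** The first-order conditions of the steady problem form a linear system with
    matrix [ham A B C], which is invertible because 0 is not an eigenvalue. *)
Lemma steady_KKT (z : 'cV[R]_p) : exists xb pb : 'cV[R]_n,
  A *m xb - B *m (B^T *m pb) = 0 /\
  - (C^T *m (C *m xb)) - A^T *m pb = - (C^T *m z).
Proof.
have Hu := mx_inj_unit ham_kernel.
pose s := invmx (ham A B C) *m col_mx 0 (- (C^T *m z)).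
have : ham A B C *m s = col_mx 0 (- (C^T *m z)) by rewrite mulmxA mulmxV// mul1mx.
by rewrite ham_mul => /eq_col_mx[E1 E2]; exists (usubmx s), (dsubmx s).
Qed.

(** The cost is quadratic, so its excess over a stationary point is exactly its
    quadratic part; the multiplier [pb] makes the linear part vanish on the
    constraint. *)
Lemma steady_cost_gap (z : 'cV[R]_p) xb pb v y :
  A *m xb - B *m (B^T *m pb) = 0 ->
  - (C^T *m (C *m xb)) - A^T *m pb = - (C^T *m z) ->
  A *m y + B *m v = 0 ->
  steady_cost C z v y = steady_cost C z (- (B^T *m pb)) xb
    + 2^-1 * dot (v + B^T *m pb) (v + B^T *m pb)
    + 2^-1 * dot (C *m (y - xb)) (C *m (y - xb)).
Proof.
move=> K1 K2 Ay; rewrite /steady_cost !sqr_enorm.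
have d0 : A *m (y - xb) + B *m (v + B^T *m pb) = 0.
  rewrite mulmxBr mulmxDr addrACA Ay add0r.
  by apply/eqP; rewrite addrC subr_eq0 eq_sym -subr_eq0 K1.
have K2' : C^T *m (C *m xb - z) = - (A^T *m pb).
  rewrite mulmxBr -[C^T *m z]opprK -K2 -opprD !opprK opprD addrA subrr.
  by rewrite sub0r.
have cross : dot (v + B^T *m pb) (- (B^T *m pb)) + dot (C *m (y - xb)) (C *m xb - z) = 0.
  rewrite dotNr [dot (C *m _) _]dot_mulmxl K2' dotNr -(dot_mulmxl A) -(dot_mulmxl B).
  by rewrite -opprD -dotDl addrC d0 dot0l oppr0.
have yE : C *m y - z = (C *m xb - z) + C *m (y - xb).
  by rewrite mulmxBr [RHS]addrC addrA subrK.
move: cross yE; set dv := v + _; set cy := C *m (y - xb); set cx := C *m xb - z.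
have vE : v = - (B^T *m pb) + dv by rewrite addrC addrK.
clearbody dv cy cx => cross yE; rewrite yE vE; move: cross.
rewrite !dotE (dotC (B^T *m pb) dv) (dotC cx cy); lra.
Qed.

Lemma KKT_steady_optimal (z : 'cV[R]_p) xb pb :
  A *m xb - B *m (B^T *m pb) = 0 ->
  - (C^T *m (C *m xb)) - A^T *m pb = - (C^T *m z) ->
  steady_optimal A B C z (- (B^T *m pb)) xb /\
  forall u x, steady_optimal A B C z u x -> u = - (B^T *m pb) /\ x = xb.
Proof.
move=> K1 K2.
have opt : A *m xb + B *m - (B^T *m pb) = 0 by rewrite mulmxN.
split.
  split => // v y Ay; rewrite (steady_cost_gap K1 K2 Ay) -addrA lerDl.
  by rewrite addr_ge0// mulr_ge0 ?dot_ge0.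
move=> u x [Ax /(_ _ _ opt)]; rewrite (steady_cost_gap K1 K2 Ax).
have := dot_ge0 (u + B^T *m pb); have := dot_ge0 (C *m (x - xb)) => c0 b0 le0.
have uE : u + B^T *m pb = 0 by apply: dot_le0; lra.
have CE : C *m (x - xb) = 0 by apply: dot_le0; lra.
have uE' : u = - (B^T *m pb) by apply/eqP; rewrite -addr_eq0 uE.
split => //; apply/eqP; rewrite -subr_eq0; apply/eqP.
have : col_mx (x - xb) 0 = 0 :> 'cV[R]_(n + n).
  apply: ham_kernel; rewrite ham_mul col_mxKu col_mxKd CE !mulmx0 !subr0 oppr0.
  have -> : A *m (x - xb) = 0; last exact: col_mx0.
  have := etrans Ax (esym opt); rewrite uE' => /addIr Axx.
  by rewrite mulmxBr Axx subrr.
by rewrite -(col_mx0 _ n n 1) => /eq_col_mx[].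
Qed.

End Hyperbolicity.

(** * Optimal controls are extremals *)

Section Extremal.
Variables (R : realType) (n m p : nat).
Variables (A : 'M[R]_n) (B : 'M[R]_(n, m)) (C : 'M[R]_(p, n)) (z : 'cV[R]_p).
Variables (T : R) (x0 x1 : 'cV[R]_n).
Hypothesis T0 : 0 < T.

Lemma derive_integral (f g : R -> R) : {within `[0, T], continuous f} ->
  (forall t : R, is_derive t 1 g (f t)) -> forall t, 0 <= t <= T ->
  g t = g 0 + Rintegral lebesgue_measure `[0, t] f.
Proof.
move=> cf gd t tT; pose G (s : R) := Rintegral lebesgue_measure `[0, s] f.
have intf := continuous_integrable cf.
have GE s : 0 <= s <= T -> G s = 0 + Rintegral lebesgue_measure `[0, s] f.
  by rewrite add0r.
have cG := integral_eq_continuous (ltW T0) intf GE.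
have dG := integral_eq_derive intf cf GE.
have cg : {within `[0, T], continuous g}.
  by apply: derivable_within_continuous => s _; have [] := gd s.
have : g t - G t = g 0 - G 0.
  apply: (@derive0_const _ (fun s => g s - G s) 0 T) => //.
  - move=> s sT; rewrite -(subrr (f s)).
    by have := is_deriveB (gd s) (dG s sT).
  - by move=> s; apply: cvgB; [exact: cg|exact: cG].
  - by rewrite lexx ltW.
rewrite {2}/G set_itv1 Rintegral_set1 subr0 => <-.
by rewrite subrK.
Qed.

Lemma admissible_smooth (u : R -> 'cV[R]_m) (x : R -> 'cV[R]_n) :
  vcont 0 T u -> (forall t, has_deriv x t (A *m x t + B *m u t)) ->
  x 0 = x0 -> x T = x1 -> admissible A B T x0 x1 u x.
Proof.
move=> cu dx xx0 xx1.
have cx : vcont 0 T x := has_deriv_vcont dx.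
have cf : vcont 0 T (fun t => A *m x t + B *m u t).
  by apply: vcontD; exact: vcont_mulmx.
split => // i.
  split.
    have /measurable_EFinP := measurable_int _ (continuous_integrable (cu i)).
    exact.
  apply: (@continuous_integrable _ (fun t => u t i 0 ^+ 2)).
  by move=> t; apply: cvgM; exact: cu.
split; first exact: (continuous_integrable (cf i)).
move=> t tT; rewrite -xx0.
exact: (derive_integral (cf i) (fun s => dx s i)).
Qed.

(** [F] accumulates the excess of the running cost of [(u, x)] over that of the
    extremal, plus [(p | x - xh)].  The costate equation cancels all terms linear
    in the differences, so [F'] is half the sum of two squares.  [F] is 0 at time
    0, and at [T] it is the cost difference, which optimality makes nonpositive;
    hence [F] is constant and the controls agree in the interior, then at the ends
    by continuity. *)
Lemma optimal_extremal (xh ph : R -> 'cV[R]_n) (u : R -> 'cV[R]_m) (x : R -> 'cV[R]_n) :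
  (forall t, has_deriv xh t (A *m xh t + B *m - (B^T *m ph t))) ->
  (forall t, has_deriv ph t (- (C^T *m (C *m xh t - z)) - A^T *m ph t)) ->
  xh 0 = x0 -> xh T = x1 ->
  optimal A B C z T x0 x1 u x -> {within `[0, T], continuous u} ->
  forall t, 0 <= t <= T -> u t = - (B^T *m ph t) /\ x t = xh t.
Proof.
move=> dxh dph xh0 xhT [[_ xP xT] opt] cu0.
pose uh t := - (B^T *m ph t).
have cph : vcont 0 T ph := has_deriv_vcont dph.
have cxh : vcont 0 T xh := has_deriv_vcont dxh.
have cuh : vcont 0 T uh by apply: vcontN; exact: vcont_mulmx.
have cu : vcont 0 T u.
  exact: continuous_vcont.
have cx : vcont 0 T x.
  move=> i; have [intx xE] := xP i.
  exact: (@integral_eq_continuous _ (fun s => (A *m x s + B *m u s) i 0)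
    (fun t => x t i 0) _ T (ltW T0) intx xE).
have cf : vcont 0 T (fun s => A *m x s + B *m u s).
  by apply: vcontD; exact: vcont_mulmx.
have dx (t : R) : 0 < t < T -> has_deriv x t (A *m x t + B *m u t).
  move=> tT i; have [intx xE] := xP i.
  exact: (@integral_eq_derive _ (fun s => (A *m x s + B *m u s) i 0)
    (fun t => x t i 0) _ T intx (cf i) xE t tT).
have xx0 : x 0 = x0.
  apply/matrixP => i j; rewrite ord1; have [_ ->] := xP i.
    by rewrite set_itv1 Rintegral_set1 addr0.
  by rewrite lexx ltW.
have adm : admissible A B T x0 x1 uh xh by exact: admissible_smooth.
have := opt _ _ adm; rewrite /cost.
pose L (v : R -> 'cV[R]_m) (y : R -> 'cV[R]_n) t :=
  dot (v t) (v t) + dot (C *m y t - z) (C *m y t - z).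
have LE (v : R -> 'cV[R]_m) (y : R -> 'cV[R]_n) :
    (fun t => enorm (v t) ^+ 2 + enorm (C *m y t - z) ^+ 2) = L v y.
  by apply/funext => t; rewrite !sqr_enorm.
rewrite !LE ler_pM2l ?invr_gt0// => leL.
have cL v y : vcont 0 T v -> vcont 0 T y -> {within `[0, T], continuous (L v y)}.
  move=> cv cy; have cCy : vcont 0 T (fun t => C *m y t - z).
    by apply: vcontD; [exact: vcont_mulmx|exact: vcont_cst].
  by move=> t; apply: cvgD; exact: continuous_dot.
have cLu := cL _ _ cu cx; have cLh := cL _ _ cuh cxh.
have iLu := continuous_integrable cLu; have iLh := continuous_integrable cLh.
pose I f (s : R) := Rintegral lebesgue_measure `[0, s] f : R.
have IE f s : 0 <= s <= T -> I f s = 0 + Rintegral lebesgue_measure `[0, s] f.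
  by rewrite add0r.
pose dy t := x t - xh t.
have cdx : vcont 0 T dy by apply: vcontD => //; exact: vcontN.
pose du t := u t - uh t.
have cdu : vcont 0 T du by apply: vcontD => //; exact: vcontN.
have ddx t : 0 < t < T -> has_deriv dy t (A *m dy t + B *m du t).
  move=> /dx dxt; have := has_derivD dxt (has_derivN (dxh t)).
  rewrite (_ : _ + - _ = A *m dy t + B *m du t)//.
  by rewrite opprD addrACA -!mulmxBr.
pose F t := 2^-1 * (I (L u x) t - I (L uh xh) t) + dot (ph t) (dy t).
pose dF t := 2^-1 * (dot (du t) (du t) + dot (C *m dy t) (C *m dy t)).
have FD (t : R) : 0 < t < T -> is_derive t 1 F (dF t).
  move=> tT.
  have dI := is_deriveB (integral_eq_derive iLu cLu (IE _) tT)
                        (integral_eq_derive iLh cLh (IE _) tT).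
  have dD := is_derive_dot (dph t) (ddx t tT).
  apply: is_derive_eq (is_deriveD (is_deriveZ 2^-1 dI) dD) _.
  rewrite /GRing.scale /= /dF /L.
  have uE : u t = uh t + du t by rewrite addrC subrK.
  have xE : C *m x t - z = (C *m xh t - z) + C *m dy t.
    by rewrite mulmxBr [RHS]addrC addrA subrK.
  rewrite uE xE; move: (du t) (dy t) (C *m xh t - z) => v y r.
  rewrite /uh !dotE.
  rewrite [dot (C^T *m _) _]dot_mulmxl trmxK (dotC (C *m y) r).
  rewrite (dotC v (B^T *m _)).
  rewrite (dot_mulmxr A) (dot_mulmxr B).
  by field.
have dF0 t : 0 <= dF t.
  by rewrite mulr_ge0// addr_ge0 ?dot_ge0.
have cF : {within `[0, T], continuous F}.
  move=> t; apply: cvgD; last exact: continuous_dot.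
  apply: cvgM; first exact: cvg_cst.
  apply: cvgB.
    exact: (integral_eq_continuous (ltW T0) iLu (IE _)).
  exact: (integral_eq_continuous (ltW T0) iLh (IE _)).
have mono := derive_ge0_le FD (fun t _ => dF0 t) cF.
have F0 : F 0 = 0.
  by rewrite /F /I set_itv1 !Rintegral_set1 subrr mulr0 /dy xx0 xh0 subrr dot0r addr0.
have FT : F T <= 0.
  rewrite /F /dy xT xhT subrr dot0r addr0 pmulr_rle0 ?invr_gt0//.
  by rewrite subr_le0.
have Fz t : 0 <= t -> t <= T -> F t = 0.
  move=> t0 tT; apply/le_anti/andP; split.
    by apply: le_trans FT; exact: mono.
  by rewrite -F0; exact: mono.
have dFz (t : R) : 0 < t < T -> dF t = 0.
  move=> tT; have [_ <-] := FD t tT.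
  apply: derive_val; apply: (@near_eq_is_derive _ _ _ (cst 0)).
    near=> s; have /andP[/ltW s0 /ltW s1] : 0 < s < T.
      by near: s; exact: near_itvoo.
    by rewrite Fz.
have du0 (t : R) : 0 < t < T -> du t = 0.
  move=> /dFz; rewrite /dF => d; apply: dot_le0.
  have := dot_ge0 (C *m dy t); lra.
(* At the ends, [|u - uh|^2] is continuous on [0, T] and has zero derivative
   inside, so it keeps its interior value. *)
have duz t : 0 <= t <= T -> du t = 0.
  have Th : 0 < T / 2 < T by rewrite divr_gt0// ltr_pdivrMr// ltr_pMr// ltr1n.
  move=> tT; apply: dot_le0; rewrite le_eqVlt; apply/orP; left; apply/eqP.
  transitivity (dot (du (T / 2)) (du (T / 2))); last by rewrite du0// dot0l.
  apply: (@derive0_const _ (fun s => dot (du s) (du s)) 0 T) => //.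
  - move=> s sT; apply: (@near_eq_is_derive _ _ _ (cst 0)).
    near=> r; have r01 : 0 < r < T by near: r; exact: near_itvoo.
    by rewrite du0// dot0l.
  - exact: continuous_dot.
  - by case/andP: Th => /ltW -> /ltW ->.
move=> t tT; split; apply/eqP; rewrite -subr_eq0; apply/eqP.
  exact: duz.
apply: (@linear_ode_unique _ _ A dy 0 T cdx _ 0 t) => //.
- move=> s sT; have := ddx s sT; rewrite duz ?mulmx0 ?addr0//.
  by case/andP: sT => /ltW -> /ltW ->.
- by rewrite lexx ltW.
- by rewrite /dy xx0 xh0 subrr.
Unshelve. all: by end_near. Qed.

End Extremal.

(** * The turnpike estimate *)

Theorem proposition4 (R : realType) (n m : nat)
    (A : 'M[R]_n) (B : 'M[R]_(n, m)) (C : 'M[R]_n) (x0 x1 z : 'cV[R]_n)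
    (hAB : controllable A B) (hAC : weak_Hautus A C) :
  exists (ubar : 'cV[R]_m) (xbar : 'cV[R]_n),
    [/\ steady_optimal A B C z ubar xbar,
        (forall u x, steady_optimal A B C z u x -> u = ubar /\ x = xbar) &
        exists K mu : R, [/\ 0 < K, 0 < mu &
          forall (T : R) (uT : R -> 'cV[R]_m) (xT : R -> 'cV[R]_n),
            2 < T ->
            optimal A B C z T x0 x1 uT xT ->
            {within `[0, T], continuous uT} ->
            forall t : R, 0 <= t <= T ->
              enorm (uT t - ubar) + enorm (xT t - xbar)
                <= K * (expR (- mu * t) + expR (- mu * (T - t)))]].
Proof.
have kal := controllable_kalman hAB.
have [xb [pb [K1 K2]]] := steady_KKT kal hAC z.
have [sopt suniq] := KKT_steady_optimal kal hAC K1 K2.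
exists (- (B^T *m pb)), xb; split => //.
have [Kd [a [Kd0 a0 decay]]] := solution_decay (ham_hyperbolic kal hAC).
have [Ke Ke0 endp] := endpoint_bound C kal.
have [h h0 hB] := mulmx_bound B^T.
pose N := dot (x0 - xb) (x0 - xb) + dot (x1 - xb) (x1 - xb).
have N0 : 0 <= N by rewrite addr_ge0 ?dot_ge0.
pose c := Kd * (Ke * N).
have c0 : 0 <= c by rewrite !mulr_ge0// ltW.
exists (Num.sqrt (h * c) + Num.sqrt c + 1), (a / 2).
split; [by rewrite ltr_wpDl// addr_ge0 ?sqrtr_ge0|by rewrite divr_gt0|].
move=> T uT xT T2 opt cu t tT.
have T1 : 1 <= T by lra.
have T0 : 0 < T by lra.
have [w [sw w0 wT]] := boundary_problem C (x0 - xb) (x1 - xb) kal T1.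
have dxh s : has_deriv (fun s => xb + usubmx (w s)) s
    (A *m (xb + usubmx (w s)) + B *m - (B^T *m (pb + dsubmx (w s)))).
  have := has_derivD (has_deriv_cst xb s) (has_deriv_state s sw).
  rewrite (_ : 0 + _ = A *m (xb + usubmx (w s)) + B *m - (B^T *m (pb + dsubmx (w s))))//.
  by rewrite -K1 !mulmxDr !mulmxN mulmxDr opprD addrACA.
have dph s : has_deriv (fun s => pb + dsubmx (w s)) s
    (- (C^T *m (C *m (xb + usubmx (w s)) - z)) - A^T *m (pb + dsubmx (w s))).
  have := has_derivD (has_deriv_cst pb s) (has_deriv_costate s sw).
  rewrite (_ : 0 + _ = - (C^T *m (C *m (xb + usubmx (w s)) - z))
      - A^T *m (pb + dsubmx (w s)))//.
  have K20 : - (C^T *m (C *m xb - z)) - A^T *m pb = 0.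
    by rewrite mulmxBr opprB -addrA K2 subrr.
  rewrite -K20 addrACA -opprD -mulmxDr -opprD -mulmxDr.
  by rewrite [C *m (_ + _)]mulmxDr addrAC.
have xh0 : xb + usubmx (w 0) = x0 by rewrite w0 addrC subrK.
have xhT : xb + usubmx (w T) = x1 by rewrite wT addrC subrK.
have [-> ->] := optimal_extremal T0 dxh dph xh0 xhT opt cu tT.
(* The squared norm decays at rate [a]; the norm itself decays at half of it. *)
pose g := expR (- (a / 2) * t) + expR (- (a / 2) * (T - t)).
have g0 : 0 <= g by rewrite addr_ge0 ?expR_ge0.
have wle : dot (w t) (w t) <= c * g ^+ 2.
  apply: le_trans (decay T w T1 sw t tT) _.
  have := endp T w T1 sw; rewrite w0 wT -/N => wN.
  have sq s : expR (- a * s) = expR (- (a / 2) * s) ^+ 2.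
    by rewrite expr2 -expRD; congr expR; field.
  rewrite (_ : c * _ = Kd * g ^+ 2 * (Ke * N)); last by rewrite /c; ring.
  apply: ler_pM => //.
  - by rewrite mulr_ge0 ?(ltW Kd0)// addr_ge0 ?expR_ge0.
  - by rewrite addr_ge0 ?dot_ge0.
  rewrite ler_wpM2l ?(ltW Kd0)// !sq /g sqrrD lerD2r lerDl.
  by rewrite mulrn_wge0// mulr_ge0 ?expR_ge0.
have split_w : dot (w t) (w t) = dot (usubmx (w t)) (usubmx (w t)) +
    dot (dsubmx (w t)) (dsubmx (w t)) by rewrite -dot_col_mx vsubmxK.
have ule : enorm (- (B^T *m (pb + dsubmx (w t))) - - (B^T *m pb)) <=
    Num.sqrt (h * c) * g.
  rewrite mulmxDr opprD addrAC subrr sub0r.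
  apply: enorm_le => //; first by rewrite mulr_ge0// ltW.
  rewrite dotNl dotNr opprK; apply: le_trans (hB _) _.
  rewrite -mulrA ler_wpM2l ?(ltW h0)//; apply: le_trans wle.
  by rewrite split_w lerDr dot_ge0.
have xle : enorm (xb + usubmx (w t) - xb) <= Num.sqrt c * g.
  rewrite addrAC subrr add0r; apply: enorm_le => //; apply: le_trans wle.
  by rewrite split_w lerDl dot_ge0.
apply: le_trans (lerD ule xle) _; rewrite -mulrDl -/g ler_wpM2r//.
by rewrite lerDl.
Qed.
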